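(* Let $(X_i,P_i)$, $i\in I$, be a family of quasi-transitive irreducible Markov chains and let $(X,P)$ be the Markov chain obtained by connecting them at a common root $r$ with weights $(\alpha_i)_{i\in I}$. Let $\varrho(P):=\inf_{i\in I}\rho(P_i)\in[0,1]$. Consider the branching Markov chain $(X,P,\mu)$ with constant offspring distribution $\mu$ with mean $m$. Then: \begin{itemize} \item[(i)] $m\le 1/\rho(P)$ if and only if $\alpha(x)=0$ for all $x\in X$; \item[(ii)] $1/\rho(P)<m<1/\varrho(P)$ if and only if $0<\alpha(x)<1$ for all $x\in X$; \item[(iii)] $1/\varrho(P)<m$ if and only if $\alpha(x)=1$ for all $x\in X$. \end{itemize} If the infimum in the definition of $\varrho(P)$ is attained, then $m=1/\varrho(P)$ implies $\alpha(x)<1$ for all $x\in X$; if the infimum is not attained, then $m=1/\varrho(P)$ implies $\alpha(x)=1$ for all $x\in X$.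
   Context: Markov chains $(X,P)$ have countably infinite state space and irreducible stochastic transition matrix $P=(p(x,y))$, with $n$-step probabilities $p^{(n)}(x,y)$; the spectral radius is $\rho(P):=\limsup_{n\to\infty}(p^{(n)}(x,y))^{1/n}\in(0,1]$, independent of $x,y$. Convention: $1/0=\infty$. Quasi-transitivity: let $X$ carry the structure of a locally finite connected graph and $P$ be the transition matrix of an irreducible random walk on $X$; $\mathrm{AUT}(X,P)$ is the group of graph automorphisms $\gamma$ of $X$ with $p(\gamma x,\gamma y)=p(x,y)$ for all $x,y\in X$. The chain $(X,P)$ is quasi-transitive if $\mathrm{AUT}(X,P)$ acts on $X$ with finitely many orbits. Connecting at a common root: given irreducible chains $(X_i,P_i)$, $i\in I$, choose a root $r_i\in X_i$ in each and identify all the roots to a single point $r$, the $X_i$ being otherwise disjoint, so $X=\bigcup_i X_i$ and $\{r\}=\bigcap_i X_i$. Choose constants $\alpha_i>0$ with $\sum_{i\in I}\alpha_i=1$ and define $P$ by: $p(x,y)=p_i(x,y)$ if $x,y\in X_i$, $x\ne r$; $p(r,y)=\alpha_i p_i(r,y)$ if $y\in X_i\setminus\{r\}$; $p(r,r)=\sum_i\alpha_i p_i(r,r)$; and $p(x,y)=0$ otherwise. Branching Markov chain $(X,P,\mu)$ with constant offspring distribution: $\mu=(\mu_k)_{k\ge1}$ is a probability distribution on $\{1,2,\dots\}$ with finite mean $m=\sum_k k\mu_k$. The process starts with one particle; at each time step each particle, located at $y$ say, is replaced by $k$ offspring with probability $\mu_k$, and each offspring then independently moves to $z$ with probability $p(y,z)$,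 everything being independent of the other particles and of the past. With $\eta(n)$ the number of particles at time $n$, $x_i(n)$ the position of the $i$-th particle at time $n$ and $\mathbb{P}_x$ the law of the process started with one particle at $x$, $$\alpha(x):=\mathbb{P}_x\Big(\sum_{n=1}^\infty\sum_{i=1}^{\eta(n)}\mathbf 1\{x_i(n)=x\}=\infty\Big).$$ (The function $\alpha(x)$ is unrelated to the weights $\alpha_i$.)
   Formalization: (ii) and (iii) are stated only for m ≠ 1/ϱ(P), since at m = 1/ϱ(P) they contradict (i) and the final sentence; and the case m = 1 with (X,P) recurrent is excluded, since there α = 1 although m ≤ 1/ρ(P). *)

(* Defs.v *)
From HB Require Import structures.
From mathcomp Require Import all_boot all_order all_algebra.
From mathcomp Require Import all_classical all_reals all_analysis.

Set Implicit Arguments.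
Unset Strict Implicit.
Unset Printing Implicit Defensive.

Import Order.TTheory GRing.Theory Num.Theory.

Local Open Scope classical_set_scope.
Local Open Scope ring_scope.

Section MarkovChain.
Context {R : realType} {T : countType}.
Implicit Types (P : T -> T -> R) (E : rel T).

Definition stochastic P : Prop :=
  (forall x y, 0 <= P x y) /\
  (forall x, (\esum_(y in [set: T]) (P x y)%:E = 1)%E).

Fixpoint nstep P (n : nat) (x y : T) : \bar R :=
  if n is k.+1 then (\esum_(z in [set: T]) ((P x z)%:E * nstep P k z y))%E
  else (x == y)%:R%:E.

Definition irreducible P : Prop := forall x y, exists n, (0 < nstep P n x y)%E.

(* For irreducible P this does not depend on x and y. *)
Definition spectral_radius P (x y : T) : \bar R :=
  limn_esup (fun n => poweR (nstep P n x y) n%:R^-1).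

Definition transient P : Prop :=
  forall x y, (\sum_(0 <= n <oo) nstep P n x y < +oo)%E.

Definition locally_finite E : Prop := forall x, finite_set [set y | E x y].

Definition connected_graph E : Prop :=
  forall x y, exists2 s : seq T, path E x s & last x s = y.

Definition AUT E P : set (T -> T) :=
  [set g | [/\ bijective g,
               forall x y, E (g x) (g y) = E x y &
               forall x y, P (g x) (g y) = P x y]].

Definition AUT_orbit E P (x : T) : set T := [set g x | g in AUT E P].

Definition quasi_transitive E P : Prop :=
  [/\ symmetric E, locally_finite E, connected_graph E &
      finite_set (range (AUT_orbit E P))].

End MarkovChain.

Section CommonRoot.
Context {R : realType} {I : countType} {X : I -> countType}.
Variable r : forall i, X i.

(* The disjoint union of the X i with the roots r i identified: None is the
   common root, Some (i, x) is a point x of X i other than r i. *)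
Definition glued : Type := option {i : I & {x : X i | x != r i}}.

HB.instance Definition _ := Countable.on glued.

Definition common_root : glued := None.

Variables (P : forall i, X i -> X i -> R) (a : I -> R).

Definition glued_chain (x y : glued) : R :=
  match x, y with
  | Some u, Some v =>
      if tag u == tag v
      then P (val (tagged u)) (val (tagged_as u v))
      else 0
  | Some u, None => P (val (tagged u)) (r (tag u))
  | None, Some v => a (tag v) * P (r (tag v)) (val (tagged v))
  | None, None => fine (\esum_(i in [set: I]) (a i * P (r i) (r i))%:E)%E
  end.

End CommonRoot.

Arguments glued_chain {R I X} r P a x y.

Definition root_weights {R : realType} {I : countType} (a : I -> R) : Prop :=
  (forall i, 0 < a i) /\ (\esum_(i in [set: I]) (a i)%:E = 1)%E.

Definition offspring_distribution {R : realType} (mu : nat -> R) (m : R) : Prop :=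
  [/\ mu 0%N = 0, forall k, 0 <= mu k,
      (\sum_(0 <= k <oo) (mu k)%:E = 1)%E &
      (\sum_(0 <= k <oo) (k%:R * mu k)%:E = m%:E)%E].

Section BranchingMarkovChain.
Context {R : realType} {T : countType}.
Variables (P : T -> T -> R) (mu : nat -> R).

(* A population is the sequence of the positions of its particles.
   [offspring_law y l]: probability that a particle at y is replaced by
   [size l] offspring, the successive ones moving to the entries of l. *)
Definition offspring_law (y : T) (l : seq T) : R :=
  mu (size l) * \prod_(z <- l) P y z.

(* Particles of s reproduce independently, and the next population lists the
   offspring of the first particle, then those of the second, and so on;
   hence the sum over all ways of cutting t into [size s] consecutive blocks. *)
Fixpoint population_step (s t : seq T) : R :=
  if s is y :: s' then
    \sum_(i < (size t).+1)
      offspring_law y (take i t) * population_step s' (drop i t)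
  else (t == [::])%:R.

(* [Z n] is the population at time n; under [Pr x] the process starts with one
   particle at x. The law is given by its finite-dimensional marginals. *)
Definition branching_Markov_chain {d : measure_display} {Omega : measurableType d}
    (Pr : T -> probability Omega R) (Z : nat -> Omega -> seq T) : Prop :=
  (forall n s, measurable (Z n @^-1` [set s])) /\
  (forall x n (s : nat -> seq T),
     Pr x [set w | forall k, (k <= n)%N -> Z k w = s k] =
     ((s 0%N == [:: x])%:R * \prod_(k < n) population_step (s k) (s k.+1))%:E).

End BranchingMarkovChain.

(* The probability that infinitely many particles (counted with
   multiplicity over all times n >= 1) are located at the starting point. *)
Definition return_probability {R : realType} {T : countType}
    {d : measure_display} {Omega : measurableType d}
    (Pr : T -> probability Omega R) (Z : nat -> Omega -> seq T) (x : T) : \bar R :=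
  Pr x [set w | (\sum_(1 <= n <oo) (\sum_(y <- Z n w) (y == x)%:R)%:E
                 = +oo :> \bar R)%E].

(* Main.v *)
Require Import Defs.
From HB Require Import structures.
From mathcomp Require Import all_boot all_order all_algebra.
From mathcomp Require Import all_classical all_reals all_analysis.
From mathcomp Require Import lra.

(** Run the branching chain from y and mark a particle when it sits at a given
    point x.  If [psi s] is the probability that a particle whose children are
    marked independently with probability s has a marked child, then all
    probabilities of interest are produced by the operator
    [branch u y = psi (sum_z p(y,z) u(z))]: iterating it gives the probability
    [hit x y] that x is ever visited and the probabilities [late x N y] that x
    is visited at or after time N, whose limit in N is alpha(x)
    ([cvg_late_return]).  If m > 1, the graph of psi over (0,1) lies strictly
    between the diagonal and its tangent m s at 0.

    That alpha(x) = 0 is equivalent to m <= 1/rho(P) holds because the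
    successive returns to x along the lines of descent form a Galton-Watson
    process with mean U(x,x|m), the generating function of the first return
    probabilities.  The proof works with the truncations [return_mass] of U,
    which are all at most 1 exactly when m <= 1/rho
    ([le_inv_spectral_radiusP]).  If they are, alpha(x) is at most
    psi (alpha(x) / m) by a union bound over first visits to x, which for m > 1
    forces alpha(x) = 0 ([critical_extinction]); for m = 1 this is transience.
    If one of them exceeds 1, a small multiple of a truncated first passage
    function is a subsolution of [branch] that lies below every [late x N]
    ([supercritical_survival]).

    The value 1 is governed by [hit] alone: alpha(x) = 1 if and only if x is
    hit almost surely from everywhere, and for m > 1 this does not depend on x
    ([return_probability1P], [hit1_change_target]).  Take x to be the common
    root.  Until it hits the root, a process started in X_i is the branching
    chain of P_i, so alpha = 1 if and only if the root is hit almost surely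
    from everywhere in each (X_i,P_i) separately ([hit_glued]).  This fails when
    m <= 1/rho(P_i), by the criterion for alpha = 0 applied to P_i.  When
    m > 1/rho(P_i), positive solutions of branch g <= g are bounded below at
    each point by a threshold which does not depend on g and is thus constant
    on orbits of automorphisms; by quasi-transitivity they are bounded below on
    X_i, and as psi is above the diagonal they equal 1 ([strong_recurrence]).

    So alpha(x) = 0 iff m <= 1/rho(P), and alpha(x) = 1 iff m > 1/rho(P_i) for
    all i, for every x.  The five claims compare these two conditions with
    the infimum of the rho(P_i). *)

Set Implicit Arguments.
Unset Strict Implicit.
Unset Printing Implicit Defensive.

Import Order.TTheory GRing.Theory Num.Theory.
Import numFieldNormedType.Exports.
Local Open Scope classical_set_scope.
Local Open Scope ring_scope.

(** * Countable sums of nonnegative numbers *)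

Section EsumComplements.
Local Open Scope ereal_scope.
Context {R : realType}.

Lemma esumZ {T : choiceType} (S : set T) (c : R) (a : T -> \bar R) :
  (0 <= c)%R -> (forall y, 0 <= a y) ->
  \esum_(y in S) (c%:E * a y) = c%:E * \esum_(y in S) a y.
Proof.
rewrite le_eqVlt => /predU1P[<- a0|c0 a0].
  by rewrite mul0e esum1// => y _; rewrite mul0e.
have half (b : R) (v : T -> \bar R) : (0 < b)%R -> (forall y, 0 <= v y) ->
    \esum_(y in S) (b%:E * v y) <= b%:E * \esum_(y in S) v y.
  move=> b0 v0; apply: ge_ereal_sup => _ [A SA <-].
  rewrite -ge0_mule_fsumr//; apply: lee_wpmul2l; first by rewrite lee_fin ltW.
  by apply: ereal_sup_ubound; exists A.
apply/eqP; rewrite eq_le half//= -lee_pdivlMl//.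
have c'0 : (0 < c^-1)%R by rewrite invr_gt0.
have ca0 y : 0 <= c%:E * a y by rewrite mule_ge0// lee_fin ltW.
apply: le_trans (half _ _ c'0 ca0); rewrite le_eqVlt; apply/orP; left; apply/eqP.
by apply: eq_esum => y _; rewrite muleA -EFinM mulVf ?mul1e// gt_eqF.
Qed.

Lemma esum_supported {T : choiceType} (A : set T) (a : T -> \bar R) :
  (forall y, ~ A y -> a y = 0) -> \esum_(y in [set: T]) a y = \esum_(y in A) a y.
Proof.
move=> a0; rewrite [RHS]esum_mkcond; apply: eq_esum => y _.
by case: ifPn => // /negP; rewrite inE => /a0.
Qed.

End EsumComplements.

Section Mean.
Local Open Scope ereal_scope.
Context {R : realType} {T : choiceType}.
Implicit Types (w : T -> R) (u v : T -> \bar R).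

(** Used with w a row of a transition matrix and with w the offspring
    distribution; u takes extended values because generating functions may be
    infinite. *)
Definition mean w u : \bar R := \esum_(y in [set: T]) ((w y)%:E * u y).

Lemma mean_ge0 w u : (forall y, 0 <= w y)%R -> (forall y, 0 <= u y) ->
  0 <= mean w u.
Proof. by move=> w0 u0; apply: esum_ge0 => y _; rewrite mule_ge0// lee_fin. Qed.

Lemma eq_mean w u v : (forall y, w y != 0%R -> u y = v y) -> mean w u = mean w v.
Proof.
by move=> uv; apply: eq_esum => y _; have [->|/uv->//] := eqVneq (w y) 0%R; rewrite !mul0e.
Qed.

Lemma le_mean w u v : (forall y, 0 <= w y)%R ->
  (forall y, w y != 0%R -> u y <= v y) -> mean w u <= mean w v.
Proof.
move=> w0 uv; apply: le_esum => y _; have [->|/uv le_uv] := eqVneq (w y) 0%R.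
  by rewrite !mul0e.
by rewrite lee_wpmul2l// lee_fin.
Qed.

Lemma meanD w u v : (forall y, 0 <= w y)%R -> (forall y, 0 <= u y) ->
  (forall y, 0 <= v y) -> mean w (fun y => u y + v y) = mean w u + mean w v.
Proof.
move=> w0 u0 v0; rewrite -esumD => [|y _|y _]; last 2 first.
- by rewrite mule_ge0// lee_fin.
- by rewrite mule_ge0// lee_fin.
by apply: eq_esum => y _; rewrite ge0_muleDr.
Qed.

Lemma meanZ w (c : R) u : (forall y, 0 <= w y)%R -> (0 <= c)%R ->
  (forall y, 0 <= u y) -> mean w (fun y => c%:E * u y) = c%:E * mean w u.
Proof.
move=> w0 c0 u0; rewrite -esumZ// => [|y]; last by rewrite mule_ge0// lee_fin.
by apply: eq_esum => y _; rewrite muleCA.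
Qed.

Lemma mean_cst w (c : R) : (forall y, 0 <= w y)%R -> (0 <= c)%R ->
  \esum_(y in [set: T]) (w y)%:E = 1 -> mean w (fun=> c%:E) = c%:E.
Proof.
move=> w0 c0 w1; rewrite /mean; under eq_esum do rewrite muleC.
by rewrite esumZ ?w1 ?mule1.
Qed.

Lemma mean_sum w (J : choiceType) (r : seq J) (F : J -> T -> \bar R) :
  (forall y, 0 <= w y)%R -> (forall j y, 0 <= F j y) ->
  mean w (fun y => \sum_(j <- r) F j y) = \sum_(j <- r) mean w (F j).
Proof.
move=> w0 F0; rewrite -esum_sum => [|y j _ _]; last by rewrite mule_ge0// lee_fin.
by apply: eq_esum => y _; rewrite ge0_sume_distrr.
Qed.

Lemma mean_ge_term w u y : (forall z, 0 <= w z)%R -> (forall z, 0 <= u z) ->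
  (w y)%:E * u y <= mean w u.
Proof.
move=> w0 u0; apply: esum_ge; exists [set y]; first by split.
by rewrite fsbig_set1.
Qed.

(** Monotone convergence: a finite partial sum passes to the limit term by
    term, and M bounds all of them. *)
Lemma mean_le_sup w (u_ : nat -> T -> \bar R) u (M : \bar R) :
  (forall y, 0 <= w y)%R -> (forall k y, 0 <= u_ k y) ->
  (forall y, nondecreasing_seq (u_ ^~ y)) ->
  (forall y, u_ ^~ y @ \oo --> u y) ->
  (forall k, mean w (u_ k) <= M) -> mean w u <= M.
Proof.
move=> w0 u0 nd cv uM; apply: ge_ereal_sup => _ [A [finA _] <-].
rewrite fsbig_finite//=.
have cvA : (fun k => \sum_(y <- finmap.enum_fset (fset_set A)) (w y)%:E * u_ k y) @ \oo -->
    \sum_(y <- finmap.enum_fset (fset_set A)) (w y)%:E * u y.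
  apply: cvg_nnesum => [y _|y _].
    by apply: nearW => k; rewrite mule_ge0// lee_fin.
  by apply: cvgeZl.
rewrite -(cvg_lim _ cvA)//; apply: lime_le; first by apply/cvg_ex; eexists; exact: cvA.
apply: nearW => k; apply: le_trans (uM k); apply: esum_ge; exists A => //.
by rewrite fsbig_finite.
Qed.

Lemma cvg_mean w (u_ : nat -> T -> \bar R) u :
  (forall y, 0 <= w y)%R -> (forall k y, 0 <= u_ k y) ->
  (forall y, nondecreasing_seq (u_ ^~ y)) ->
  (forall y, u_ ^~ y @ \oo --> u y) ->
  (fun k => mean w (u_ k)) @ \oo --> mean w u.
Proof.
move=> w0 u0 nd cv.
have ndm : nondecreasing_seq (fun k => mean w (u_ k)).
  by move=> k l kl; apply: le_mean => // y _; exact: nd.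
suff -> : mean w u = ereal_sup (range (fun k => mean w (u_ k))).
  exact: ereal_nondecreasing_cvgn.
apply/eqP; rewrite eq_le; apply/andP; split.
  by apply: (mean_le_sup w0 u0 nd cv) => k; apply: ereal_sup_ubound; exists k.
apply: ge_ereal_sup => _ [k _ <-]; apply: le_mean => // y _.
rewrite -(cvg_lim _ (cv y))//; apply: lime_ge; first by apply/cvg_ex; eexists; exact: cv.
by exists k => // l /= kl; exact: nd.
Qed.

End Mean.

(** * Thinning the offspring of one particle *)

Section Bernoulli.
Context {R : realFieldType}.
Implicit Types s t : R.

Lemma ler_subX s t k : 0 <= s -> s <= t -> t <= 1 ->
  t ^+ k - s ^+ k <= k%:R * (t - s).
Proof.
move=> s0 st t1; elim: k => [|k IH]; first by rewrite !expr0 mul0r; lra.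
have tk1 : t ^+ k <= 1 by apply: exprn_ile1 => //; lra.
have tk0 : 0 <= t ^+ k by apply: exprn_ge0; lra.
have sk : s ^+ k <= t ^+ k by apply: lerXn2r => //; rewrite nnegrE; lra.
have -> : t ^+ k.+1 - s ^+ k.+1 = t ^+ k * (t - s) + s * (t ^+ k - s ^+ k).
  by rewrite !exprS; lra.
rewrite -natr1; nra.
Qed.

(** Second order Bonferroni inequality: the union bound k s for the
    probability that one of k events occurs is off by at most (k s)^2, which
    makes m the slope of [psi] at 0. *)
Lemma bonferroni2 s k : 0 <= s -> s <= 1 ->
  k%:R * s - (k%:R * s) ^+ 2 <= 1 - (1 - s) ^+ k.
Proof.
move=> s0 s1; elim: k => [|k IH]; first by rewrite !mul0r expr0 expr2; lra.
have k0 : 0 <= k%:R :> R by rewrite ler0n.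
have kle : 1 - (1 - s) ^+ k <= k%:R * s.
  have := @ler_subX (1 - s) 1 k; rewrite expr1n; lra.
rewrite -natr1 [(1 - s) ^+ k.+1]exprS.
move: ((1 - s) ^+ k) (k%:R : R) k0 IH kle => A K K0; rewrite !expr2 => IH kle.
have : s * (1 - A) <= s * (K * s) by rewrite ler_wpM2l.
have : 0 <= s * (K * s) by rewrite !mulr_ge0.
have : 0 <= s * s by rewrite mulr_ge0.
lra.
Qed.

(** If one of k objects is marked with probability s, the first marked one
    survives a further thinning by c with probability c. *)
Lemma thinned_exprn_concave (c s : R) k : 0 <= c -> c <= 1 -> 0 <= s -> s <= 1 ->
  c * (1 - (1 - s) ^+ k) <= 1 - (1 - c * s) ^+ k.
Proof.
move=> c0 c1 s0 s1; elim: k => [|k IH]; first by rewrite !expr0; lra.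
have cs1 : c * s <= s by nra.
have cs0 : 0 <= c * s by nra.
have sk : (1 - s) ^+ k <= 1 by apply: exprn_ile1; lra.
have sk0 : 0 <= (1 - s) ^+ k by apply: exprn_ge0; lra.
have csk : (1 - s) ^+ k <= (1 - c * s) ^+ k by apply: lerXn2r; rewrite ?nnegrE; lra.
rewrite !exprS.
move: ((1 - s) ^+ k) ((1 - c * s) ^+ k) IH sk sk0 csk => A B IH sk sk0 csk.
have : c * s * (B - A) >= 0 by rewrite mulr_ge0//; lra.
lra.
Qed.

End Bernoulli.

Section Thinning.
Context {R : realType}.
Variables (mu : nat -> R) (m : R).
Hypothesis mu_m : offspring_distribution mu m.

(** The probability that a particle has a marked child, if each child is marked
    independently with probability s: in terms of the generating function f of
    mu, this is 1 - f(1 - s). *)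
Definition psi (s : R) : R := fine (mean mu (fun k => (1 - (1 - s) ^+ k)%:E)).

Let mu0 : mu 0%N = 0. Proof. by case: mu_m. Qed.
Let mu_ge0 k : 0 <= mu k. Proof. by case: mu_m. Qed.

Lemma offspring_mass : (\esum_(k in [set: nat]) (mu k)%:E = 1)%E.
Proof.
by case: mu_m => _ _ <- _; rewrite nneseries_esumT// => k; rewrite lee_fin.
Qed.

Lemma offspring_mean : mean mu (fun k => (k%:R)%:E) = m%:E.
Proof.
case: mu_m => _ _ _ <-; rewrite nneseries_esumT => [|k].
  by apply: eq_esum => k _; rewrite -EFinM mulrC.
by rewrite lee_fin mulr_ge0.
Qed.

Let term_ge0 (s : R) k : 0 <= s -> s <= 1 -> 0 <= 1 - (1 - s) ^+ k.
Proof. by move=> s0 s1; rewrite subr_ge0 exprn_ile1//; lra. Qed.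

Let term_le1 (s : R) k : 0 <= s -> s <= 1 -> 1 - (1 - s) ^+ k <= 1.
Proof. by move=> s0 s1; rewrite gerBl exprn_ge0//; lra. Qed.

Lemma psiE s : 0 <= s -> s <= 1 ->
  (psi s)%:E = mean mu (fun k => (1 - (1 - s) ^+ k)%:E).
Proof.
move=> s0 s1; rewrite fineK// ge0_fin_numE; last first.
  by apply: mean_ge0 => // k; rewrite lee_fin term_ge0.
apply: (@le_lt_trans _ _ (1 : R)%:E); last exact: ltry.
rewrite -[leRHS](mean_cst mu_ge0 (@ler01 R) offspring_mass).
by apply: le_mean => // k _; rewrite lee_fin term_le1.
Qed.

Lemma psi_ge0 s : 0 <= s -> s <= 1 -> 0 <= psi s.
Proof.
move=> s0 s1; rewrite -lee_fin psiE//; apply: mean_ge0 => // k.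
by rewrite lee_fin term_ge0.
Qed.

Lemma psi_le1 s : 0 <= s -> s <= 1 -> psi s <= 1.
Proof.
move=> s0 s1; rewrite -lee_fin psiE//.
rewrite -[leRHS](mean_cst mu_ge0 (@ler01 R) offspring_mass).
by apply: le_mean => // k _; rewrite lee_fin term_le1.
Qed.

Lemma psi1 : psi 1 = 1.
Proof.
apply: EFin_inj; rewrite psiE// -[RHS](mean_cst mu_ge0 (@ler01 R) offspring_mass).
apply: eq_mean => -[|k _]; first by rewrite mu0 eqxx.
by rewrite subrr expr0n subr0.
Qed.

Lemma psi_mono s t : 0 <= s -> s <= t -> t <= 1 -> psi s <= psi t.
Proof.
move=> s0 st t1; rewrite -lee_fin !psiE//; [|lra|lra].
apply: le_mean => // k _; rewrite lee_fin lerB//.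
by apply: lerXn2r; rewrite ?nnegrE; lra.
Qed.

(** A child marked under t but not under s is needed for the difference, and
    there are m (t - s) of them in the mean. *)
Lemma psi_lipschitz s t : 0 <= s -> s <= t -> t <= 1 ->
  psi t <= psi s + m * (t - s).
Proof.
move=> s0 st t1; rewrite -lee_fin EFinD EFinM [(m%:E * _)%E]muleC.
rewrite !psiE//; [|lra|lra].
rewrite -offspring_mean -meanZ//; [|lra].
rewrite -meanD// => [|k|k]; last 2 first.
- by rewrite lee_fin term_ge0//; lra.
- by rewrite -EFinM lee_fin mulr_ge0//; lra.
apply: le_mean => // k _; rewrite lee_fin.
have := @ler_subX R (1 - t) (1 - s) k; lra.
Qed.

Lemma psi0 : psi 0 = 0.
Proof.
apply: EFin_inj; rewrite psiE// /mean esum1// => k _.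
by rewrite subr0 expr1n subrr mule0.
Qed.

Lemma psi_le s : 0 <= s -> s <= 1 -> psi s <= m * s.
Proof. by move=> s0 s1; have := psi_lipschitz (lexx 0) s0 s1; rewrite psi0; lra. Qed.

(** Every particle has at least one child. *)
Lemma psi_ge s : 0 <= s -> s <= 1 -> s <= psi s.
Proof.
move=> s0 s1; rewrite -lee_fin psiE// -[leLHS](mean_cst mu_ge0 s0 offspring_mass).
apply: le_mean => // -[|k _]; first by rewrite mu0 eqxx.
rewrite lee_fin exprS; have : (1 - s) ^+ k <= 1 by apply: exprn_ile1; lra.
nra.
Qed.

Lemma psi_concave c s : 0 <= c -> c <= 1 -> 0 <= s -> s <= 1 ->
  c * psi s <= psi (c * s).
Proof.
move=> c0 c1 s0 s1; have cs0 : 0 <= c * s by rewrite mulr_ge0.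
have cs1 : c * s <= 1 by nra.
rewrite -lee_fin EFinM !psiE// -meanZ// => [|k]; last by rewrite lee_fin term_ge0.
by apply: le_mean => // k _; rewrite lee_fin thinned_exprn_concave.
Qed.

(** The complement 1 - psi s is the sum of the mu_k (1 - s)^k, one of which is
    positive. *)
Lemma psi_lt1 s : 0 <= s -> s < 1 -> psi s < 1.
Proof.
move=> s0 s1; have s1' := ltW s1; rewrite lt_neqAle psi_le1// andbT; apply/eqP => ps1.
have e : (1%:E = mean mu (fun k => (1 - (1 - s) ^+ k)%:E) +
               mean mu (fun k => ((1 - s) ^+ k)%:E))%E.
  rewrite -meanD// => [|k|k]; last 2 first.
  - by rewrite lee_fin term_ge0.
  - by rewrite lee_fin exprn_ge0//; lra.
  rewrite -[LHS](mean_cst mu_ge0 (@ler01 R) offspring_mass).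
  by apply: eq_mean => k _; rewrite -EFinD subrK.
move: e; rewrite -psiE// ps1 => e.
have mu00 k : mu k = 0.
  apply/eqP; have : ((mu k)%:E * ((1 - s) ^+ k)%:E <= 0)%E.
    have -> : 0%E = mean mu (fun k => ((1 - s) ^+ k)%:E).
      by apply/esym; move: e; case: (mean _ _) => [x [] /eqP| |]//; rewrite -subr_eq0 opprD addrA subrr add0r oppr_eq0 => /eqP ->.
    by apply: mean_ge_term => // j; rewrite lee_fin exprn_ge0//; lra.
  rewrite -EFinM lee_fin pmulr_lle0 => [mk|]; last by rewrite exprn_gt0//; lra.
  by rewrite eq_le mk mu_ge0.
by have := offspring_mass; rewrite esum1 => [/eqP|k _]; rewrite ?mu00// eqe eq_sym oner_eq0.
Qed.

Lemma mean_offspring_ge1 : 1 <= m.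
Proof. by have := psi_le ler01 (lexx 1); rewrite psi1 mulr1. Qed.

(** This is where m > 1 makes the process differ from a single Markov chain. *)
Lemma some_branching : 1 < m -> exists2 k, (2 <= k)%N & 0 < mu k.
Proof.
move=> m1; apply: contrapT => nk; move: m1; apply/negP; rewrite -leNgt.
rewrite -lee_fin -offspring_mean -[leRHS](mean_cst mu_ge0 (@ler01 R) offspring_mass).
apply: le_mean => // k muk; rewrite lee_fin -[1]/(1%:R) ler_nat leqNgt; apply/negP => k2.
by apply: nk; exists k => //; rewrite lt_neqAle eq_sym muk mu_ge0.
Qed.

(** With positive probability there are k >= 2 children, and then a second
    child can be marked when the first one is not. *)
Lemma psi_gt s : 1 < m -> 0 < s -> s < 1 -> s < psi s.
Proof.
move=> m1 s0 s1; have [k k2 muk] := some_branching m1.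
have s0' := ltW s0; have s1' := ltW s1.
pose gap j := 1 - (1 - s) ^+ j.+1 - s.
have gapE j : gap j = (1 - s) * (1 - (1 - s) ^+ j) by rewrite /gap exprS; lra.
have gap0 j : 0 <= gap j by rewrite gapE mulr_ge0 ?term_ge0//; lra.
have gapk : 0 < mu k * gap k.-1.
  case: k k2 muk => [|[|k]]//= _ muk; rewrite mulr_gt0// gapE mulr_gt0//; first lra.
  rewrite subr_gt0 exprn_ilt1//; lra.
apply: (@lt_le_trans _ _ (s + mu k * gap k.-1)); first by rewrite ltrDl.
rewrite -lee_fin psiE// EFinD -[X in (X + _)%E](mean_cst mu_ge0 s0' offspring_mass).
rewrite EFinM.
apply: (@le_trans _ _ (mean mu (cst s%:E) + mean mu (fun j => (gap j.-1)%:E))%E).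
  by rewrite leeD2l//; apply: (mean_ge_term _ mu_ge0) => j; rewrite lee_fin.
rewrite -meanD// => [|j]; last by rewrite lee_fin.
apply: le_mean => // -[|j _]; first by rewrite mu0 eqxx.
by rewrite -EFinD lee_fin /gap/=; lra.
Qed.

(** The union bound is strict as soon as two children can be marked at once. *)
Lemma psi_lt s : 1 < m -> 0 < s -> s <= 1 -> psi s < m * s.
Proof.
move=> m1 s0 s1; have [k k2 muk] := some_branching m1.
have s0' := ltW s0.
pose gap j := j%:R * s - (1 - (1 - s) ^+ j).
have gap0 j : 0 <= gap j.
  by have := @ler_subX R (1 - s) 1 j; rewrite /gap expr1n; lra.
have gapk : 0 < mu k * gap k.
  rewrite mulr_gt0//; case: k k2 {muk} => [|[|k]]// _.
  rewrite /gap -addn1 natrD mulrDl mul1r exprD expr1.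
  have := gap0 k.+1; rewrite /gap.
  have : (1 - s) ^+ k.+1 < 1 by rewrite exprn_ilt1//; lra.
  nra.
apply: (@lt_le_trans _ _ (psi s + mu k * gap k)); first by rewrite ltrDl.
rewrite -lee_fin EFinD psiE// !EFinM [(m%:E * _)%E]muleC -offspring_mean -meanZ//.
apply: (@le_trans _ _ (mean mu (fun k => (1 - (1 - s) ^+ k)%:E) +
                      mean mu (fun j => (gap j)%:E))%E).
  by rewrite leeD2l//; apply: (mean_ge_term _ mu_ge0) => j; rewrite lee_fin.
rewrite -meanD//; last by move=> j; rewrite lee_fin term_ge0.
by apply: le_mean => // j _; rewrite -EFinD -EFinM lee_fin /gap mulrC; lra.
Qed.

(** The slope of [psi] at 0 is m.  Finitely many terms of the mean already exceed
    m', and for them the quadratic error of [bonferroni2] is negligible up to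
    some e; beyond e monotonicity of [psi] takes over. *)
Lemma psi_slope m' : 0 <= m' -> m' < m -> exists2 e, 0 < e &
  forall t, 0 <= t -> t <= 1 -> m' * Num.min t e <= psi t.
Proof.
move=> m'0 m'm.
have [K K_m'] : exists K, m' < \sum_(k < K) mu k * k%:R.
  apply: contrapT => nK.
  suff : (m%:E <= m'%:E)%E by rewrite lee_fin leNgt m'm.
  rewrite -offspring_mean /mean -nneseries_esumT => [|k]; last first.
    by rewrite -EFinM lee_fin mulr_ge0.
  apply: lime_le; first by apply: is_cvg_nneseries => k _ _; rewrite -EFinM lee_fin mulr_ge0.
  apply: nearW => K; under eq_bigr do rewrite -EFinM.
  rewrite sumEFin lee_fin leNgt; apply/negP => h; apply: nK; exists K.
  by rewrite big_mkord in h.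
set A := \sum_(k < K) mu k * k%:R in K_m'.
pose B := \sum_(k < K) mu k * k%:R ^+ 2.
have B0 : 0 <= B by apply: sumr_ge0 => k _; rewrite mulr_ge0// exprn_ge0.
have quad t : 0 <= t -> t <= 1 -> A * t - B * t ^+ 2 <= psi t.
  move=> t0 t1; rewrite -lee_fin psiE// /mean -nneseries_esumT => [|k]; last first.
    by rewrite -EFinM lee_fin mulr_ge0// term_ge0.
  apply: le_trans; last first.
    by apply: (nneseries_lim_ge K) => k _; rewrite -EFinM lee_fin mulr_ge0// term_ge0.
  under eq_bigr do rewrite -EFinM.
  rewrite sumEFin lee_fin big_mkord /A /B !mulr_suml -sumrB.
  apply: ler_sum => k _.
  have := ler_wpM2l (mu_ge0 k) (bonferroni2 k t0 t1).
  by rewrite exprMn !mulrBr !mulrA.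
(* below this e the quadratic error B t^2 is at most (A - m') t *)
pose e := Num.min 1 ((A - m') / (B + 1)).
have e0 : 0 < e by rewrite lt_min ltr01 divr_gt0 ?subr_gt0//; lra.
have eB : e * (B + 1) <= A - m'.
  by rewrite -ler_pdivlMr ?ge_min ?lexx ?orbT//; lra.
have e1 : e <= 1 by rewrite ge_min lexx.
exists e => // t t0 t1.
have s0 : 0 <= Num.min t e by rewrite le_min t0 ltW.
have st : Num.min t e <= t by rewrite ge_min lexx.
have se : Num.min t e <= e by rewrite ge_min lexx orbT.
move: (Num.min t e) s0 st se => s s0 st se.
apply: le_trans (psi_mono s0 st t1); apply: le_trans (quad _ s0 _); last lra.
have : s * (B + 1) <= e * (B + 1) by apply: ler_wpM2r => //; lra.
rewrite expr2; nra.
Qed.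

End Thinning.

(** * Irreducibility as an induction principle *)

Section Irreducibility.
Context {R : realType} {T : countType}.
Variable P : T -> T -> R.
Hypothesis P_ge0 : forall x y, 0 <= P x y.

Lemma nstep_ge0 n x y : (0 <= nstep P n x y)%E.
Proof.
elim: n x => [|n IH] x /=; first by rewrite lee_fin ler0n.
by apply: esum_ge0 => z _; rewrite mule_ge0// lee_fin.
Qed.

(** The form in which irreducibility is used: a property inherited by the
    points that can jump to a point having it spreads over the whole space. *)
Lemma irreducible_ind : irreducible P ->
  forall S : T -> Prop, (forall x z, 0 < P x z -> S z -> S x) ->
  forall x y, S y -> S x.
Proof.
move=> irr S SP x y Sy; have [n] := irr x y.
elim: n x => [|n IH] x /=; first by case: eqP => [->//|_]; rewrite ltxx.
move=> n0; apply: contrapT => nSx; move: n0; apply/negP; rewrite -leNgt.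
rewrite le_eqVlt; apply/orP; left; apply/eqP; apply: esum1 => z _.
have [->|Pxz] := eqVneq (P x z) 0; first by rewrite mul0e.
have [n0|] := ltP 0%E (nstep P n z y).
  by exfalso; apply: nSx; apply: (SP _ z); [rewrite lt_neqAle eq_sym Pxz P_ge0|exact: IH].
move=> n0; have /eqP -> : nstep P n z y == 0%E by rewrite eq_le n0 nstep_ge0.
by rewrite mule0.
Qed.

Lemma ind_irreducible :
  (forall S : T -> Prop, (forall x z, 0 < P x z -> S z -> S x) ->
    forall x y, S y -> S x) -> irreducible P.
Proof.
move=> ind x y; apply: (ind (fun x => exists n, (0 < nstep P n x y)%E) _ x y).
  move=> {}x z Pxz [n nz]; exists n.+1 => /=.
  apply: (@lt_le_trans _ _ ((P x z)%:E * nstep P n z y)%E).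
    by rewrite mule_gt0// lte_fin.
  by apply: mean_ge_term => // t; exact: nstep_ge0.
by exists 0%N; rewrite /= eqxx lte_fin ltr01.
Qed.

End Irreducibility.

(** * Hitting probabilities of the branching chain *)

Section Hitting.
Context {R : realType} {T : countType}.
Variables (P : T -> T -> R) (mu : nat -> R) (m : R).
Hypothesis P_stochastic : stochastic P.
Hypothesis mu_m : offspring_distribution mu m.
Implicit Types (u v g : T -> R).

Let P_ge0 x y : 0 <= P x y. Proof. by case: P_stochastic. Qed.
Let P_sum x : (\esum_(y in [set: T]) (P x y)%:E = 1)%E.
Proof. by case: P_stochastic. Qed.

Definition avg (u : T -> R) (y : T) : R := fine (mean (P y) (EFin \o u)).

(** The probability that some child of a particle at y is marked, a child at z
    being marked with probability u z. *)
Definition branch (u : T -> R) (y : T) : R := psi mu (avg u y).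

Definition unitf u := forall y, 0 <= u y <= 1.

Lemma avgE u y : unitf u -> (avg u y)%:E = mean (P y) (EFin \o u).
Proof.
move=> u01; rewrite fineK// ge0_fin_numE; last first.
  by apply: mean_ge0 => // z; rewrite lee_fin; case/andP: (u01 z).
apply: (@le_lt_trans _ _ (1 : R)%:E); last exact: ltry.
rewrite -[leRHS](mean_cst (P_ge0 y) (@ler01 R) (P_sum y)).
by apply: le_mean => // z _; rewrite lee_fin; case/andP: (u01 z).
Qed.

Lemma avg_mono u v y : unitf u -> unitf v -> (forall z, u z <= v z) ->
  avg u y <= avg v y.
Proof.
move=> u01 v01 uv; rewrite -lee_fin !avgE//; apply: le_mean => // z _.
by rewrite lee_fin.
Qed.

Lemma unitf_cst (c : R) : 0 <= c <= 1 -> unitf (fun=> c).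
Proof. by move=> ? ?. Qed.

Lemma avg_cst (c : R) y : 0 <= c <= 1 -> avg (fun=> c) y = c.
Proof.
move=> c01; apply: EFin_inj; rewrite avgE; last exact: unitf_cst.
by apply: mean_cst => //; case/andP: c01.
Qed.

Lemma avg01 u y : unitf u -> 0 <= avg u y <= 1.
Proof.
move=> u01; have z1 : 0 <= (1 : R) <= 1 by rewrite ler01 lexx.
have z0 : 0 <= (0 : R) <= 1 by rewrite ler01 lexx.
apply/andP; split; [rewrite -(avg_cst y z0)|rewrite -[leRHS](avg_cst y z1)]; 
  by apply: avg_mono => //; try exact: unitf_cst; move=> z; case/andP: (u01 z).
Qed.

Lemma branch_unit u : unitf u -> unitf (branch u).
Proof.
move=> u01 y; have /andP[s0 s1] := avg01 y u01.
by rewrite (psi_ge0 mu_m)// (psi_le1 mu_m).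
Qed.

Lemma branch_mono u v : unitf u -> unitf v -> (forall z, u z <= v z) ->
  forall y, branch u y <= branch v y.
Proof.
move=> u01 v01 uv y; apply: (psi_mono mu_m); last 1 first.
- by case/andP: (avg01 y v01).
- by case/andP: (avg01 y u01).
- exact: avg_mono.
Qed.

Lemma branch_scale u (c : R) : 0 <= c <= 1 -> unitf u ->
  forall y, c * branch u y <= branch (fun z => c * u z) y.
Proof.
move=> /andP[c0 c1] u01 y; have /andP[s0 s1] := avg01 y u01.
have cu01 : unitf (fun z => c * u z).
  by move=> z; have /andP[? ?] := u01 z; rewrite mulr_ge0//= mulr_ile1.
apply: le_trans (psi_concave mu_m c0 c1 s0 s1) _.
suff -> : c * avg u y = avg (fun z => c * u z) y by [].
apply: EFin_inj; rewrite EFinM !avgE// -meanZ// => z.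
by rewrite lee_fin; case/andP: (u01 z).
Qed.

Lemma branch1 y : branch (fun=> 1) y = 1.
Proof. by rewrite /branch avg_cst ?ler01 ?lexx// (psi1 mu_m). Qed.

Lemma cvg_avg (u_ : nat -> T -> R) u y : (forall k, unitf (u_ k)) -> unitf u ->
  (forall z, nondecreasing_seq (u_ ^~ z)) -> (forall z, u_ ^~ z @ \oo --> u z) ->
  (fun k => avg (u_ k) y) @ \oo --> avg u y.
Proof.
move=> uk01 u01 nd cv; apply: fine_cvg; rewrite -/(avg u y) avgE//.
apply: cvg_mean => //.
- by move=> k z; rewrite lee_fin; case/andP: (uk01 k z).
- by move=> z; apply: cvg_EFin; [exact: nearW|exact: cv z].
Qed.

(** The averages converge monotonically, and [psi] is Lipschitz. *)
Lemma cvg_branch (u_ : nat -> T -> R) u y : (forall k, unitf (u_ k)) -> unitf u ->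
  (forall z, nondecreasing_seq (u_ ^~ z)) -> (forall z, u_ ^~ z @ \oo --> u z) ->
  (fun k => branch (u_ k) y) @ \oo --> branch u y.
Proof.
move=> uk01 u01 nd cv.
have le_u k z : u_ k z <= u z.
  rewrite -(cvg_lim _ (cv z))//; apply: nondecreasing_cvgn_le => //.
  by apply/cvg_ex; eexists; exact: cv.
have cva := cvg_avg (y := y) uk01 u01 nd cv.
apply: (@squeeze_cvgr _ _ _ _ (fun k => branch u y - m * (avg u y - avg (u_ k) y))
          (fun=> branch u y)).
- apply: nearW => k; rewrite branch_mono// andbT lerBlDr.
  apply: (psi_lipschitz mu_m); [by case/andP: (avg01 y (uk01 k))| |
    by case/andP: (avg01 y u01)].
  exact: avg_mono.
- rewrite -[X in _ --> X]subr0; apply: cvgB; first exact: cvg_cst.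
  rewrite -[X in _ --> X](mulr0 m); apply: cvgMl_tmp.
  by rewrite -[X in _ --> X](subrr (avg u y)); apply: cvgB => //; exact: cvg_cst.
- exact: cvg_cst.
Qed.

(** The probability that the branching chain started at y visits x at one of the
    times 0, ..., k-1. *)
Fixpoint hit_before (x : T) (k : nat) (y : T) : R :=
  if k is k'.+1 then if y == x then 1 else branch (hit_before x k') y else 0.

Lemma hit_before_unit x k : unitf (hit_before x k).
Proof.
elim: k => [|k IH] y /=; first by rewrite lexx ler01.
by case: ifP => _; [rewrite ler01 lexx|exact: branch_unit].
Qed.

Lemma hit_before_nd x y : nondecreasing_seq (hit_before x ^~ y).
Proof.
suff H k z : hit_before x k z <= hit_before x k.+1 z by apply/nondecreasing_seqP => k.
elim: k z => [|k IH] z.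
  by case/andP: (hit_before_unit x 1 z).
rewrite [leLHS]/= [leRHS]/=; case: ifP => // _.
apply: branch_mono; [exact: hit_before_unit|exact: (hit_before_unit x k.+1)|exact: IH].
Qed.

Definition hit (x y : T) : R := limn (hit_before x ^~ y).

Lemma cvg_hit x y : hit_before x ^~ y @ \oo --> hit x y.
Proof.
apply: nondecreasing_is_cvgn; first exact: hit_before_nd.
by exists 1 => _ [k _ <-]; case/andP: (hit_before_unit x k y).
Qed.

Lemma hit_before_le x k y : hit_before x k y <= hit x y.
Proof.
apply: nondecreasing_cvgn_le; first exact: hit_before_nd.
by apply/cvg_ex; eexists; exact: cvg_hit.
Qed.

Lemma hit_unit x : unitf (hit x).
Proof.
move=> y; have c : cvgn (hit_before x ^~ y) by apply/cvg_ex; eexists; exact: cvg_hit.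
apply/andP; split; [apply: limr_ge => //|apply: limr_le => //];
  by apply: nearW => k; case/andP: (hit_before_unit x k y).
Qed.

Lemma hit_self x : hit x x = 1.
Proof.
have /andP[_ h1] := hit_unit x x; apply/eqP; rewrite eq_le h1/=.
by have := hit_before_le x 1 x; rewrite /= eqxx.
Qed.

Lemma hit_step x y : y != x -> hit x y = branch (hit x) y.
Proof.
move=> yx; apply: cvg_lim => //; rewrite -cvg_shiftS /= (negbTE yx).
apply: cvg_branch.
- exact: hit_before_unit.
- exact: hit_unit.
- exact: hit_before_nd.
- exact: cvg_hit.
Qed.

Lemma branch_hit_le x y : branch (hit x) y <= hit x y.
Proof.
have [->|yx] := eqVneq y x; last by rewrite -hit_step.
by rewrite hit_self; case/andP: (branch_unit (hit_unit x) x).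
Qed.

(** Hitting probabilities of x are minimal among the solutions g >= 0 of
    branch g <= g with g x = 1.  Other values of g x reduce to this one since
    concavity of [psi] gives c * branch u <= branch (c * u). *)
Lemma supersolution_hit g x : unitf g -> (forall y, branch g y <= g y) ->
  forall y, g x * hit x y <= g y.
Proof.
move=> g01 gs y.
have gk k z : g x * hit_before x k z <= g z.
  elim: k z => [|k IH] z /=; first by rewrite mulr0; case/andP: (g01 z).
  case: eqP => [->|_]; first by rewrite mulr1.
  apply: le_trans (branch_scale (g01 x) (hit_before_unit x k) z) _.
  apply: le_trans (gs z); apply: branch_mono => // t.
  have /andP[? ?] := g01 x; have /andP[? ?] := hit_before_unit x k t.
  by rewrite mulr_ge0//= mulr_ile1.
have c : (fun k => g x * hit_before x k y) @ \oo --> g x * hit x y.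
  by apply: cvgMl_tmp; exact: cvg_hit.
rewrite -(cvg_lim _ c)//; apply: limr_le; first by apply/cvg_ex; eexists; exact: c.
exact: nearW.
Qed.

(** The infimum i of g satisfies psi i <= i, whereas psi s > s on (0,1). *)
Lemma supersolution_eq1 g (c : R) : 1 < m -> unitf g ->
  (forall y, branch g y <= g y) -> 0 < c -> (forall y, c <= g y) ->
  forall y, g y = 1.
Proof.
move=> m1 g01 gs c0 cg y.
pose i := inf (range g).
have hi : has_inf (range g) by split; [exists (g y), y|exists c => _ [z _ <-]].
have ig z : i <= g z by apply: ge_inf; [exact: hi.2|exists z].
have ci : c <= i by apply: lb_le_inf; [exact: hi.1|move=> _ [z _ <-]].
have i1 : i <= 1 by apply: le_trans (ig y) _; case/andP: (g01 y).
have i01 : 0 <= i <= 1 by rewrite i1 andbT; lra.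
have : ~~ (i < 1).
  apply/negP => ilt1; have : i < psi mu i by apply: (psi_gt mu_m) => //; lra.
  apply/negP; rewrite -leNgt; apply: lb_le_inf; first exact: hi.1.
  move=> _ [z _ <-]; apply: le_trans (gs z).
  rewrite -(avg_cst z i01) -/(branch _ z).
  by apply: branch_mono => //; exact: unitf_cst.
rewrite -leNgt => i1'; apply/eqP; rewrite eq_le (le_trans i1' (ig y)) andbT.
by case/andP: (g01 y).
Qed.

Hypothesis P_irreducible : irreducible P.

Lemma supersolution_gt0 g x : unitf g -> (forall y, branch g y <= g y) ->
  0 < g x -> forall y, 0 < g y.
Proof.
move=> g01 gs gx y.
apply: (irreducible_ind P_ge0 P_irreducible (S := fun y => 0 < g y) _ y gx) => z t Pzt gt.
apply: lt_le_trans (gs z); have /andP[a0 a1] := avg01 z g01.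
apply: lt_le_trans (psi_ge mu_m a0 a1).
apply: (@lt_le_trans _ _ (P z t * g t)); first exact: mulr_gt0.
rewrite -lee_fin avgE// EFinM; apply: (mean_ge_term t (P_ge0 z)) => s /=.
by rewrite lee_fin; case/andP: (g01 s).
Qed.

Lemma hit_gt0 x y : 0 < hit x y.
Proof.
apply: (supersolution_gt0 (x := x)); [exact: hit_unit|exact: branch_hit_le|].
by rewrite hit_self.
Qed.

(** If x is hit from everywhere then r is hit from everywhere with at least the
    probability that it is hit from x: [hit r] is bounded below, hence 1. *)
Lemma hit1_change_target x r : 1 < m ->
  (forall y, hit x y = 1) -> forall y, hit r y = 1.
Proof.
move=> m1 hx; apply: (supersolution_eq1 m1 (hit_unit r) (branch_hit_le r) (hit_gt0 r x)).
move=> y; rewrite -[leLHS]mulr1 -(hx y).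
by apply: supersolution_hit; [exact: hit_unit|exact: branch_hit_le].
Qed.

(** The probability that the branching chain started at y visits x at some
    time >= N. *)
Definition late (x : T) (N : nat) : T -> R := iter N branch (hit x).

Lemma late_unit x N : unitf (late x N).
Proof. by elim: N => [|N IH]; [exact: hit_unit|exact: branch_unit]. Qed.

Lemma late_ni x y : nonincreasing_seq (late x ^~ y).
Proof.
suff H N z : late x N.+1 z <= late x N z by apply/nonincreasing_seqP => N.
elim: N z => [|N IH] z; first exact: branch_hit_le.
apply: branch_mono; [exact: (late_unit x N.+1)|exact: late_unit|exact: IH].
Qed.

(** If a particle at z has arbitrarily late visits of x with probability 1, so
    has every possible child of it: otherwise, since psi s < 1 for s < 1, all
    children could fail.  By irreducibility this spreads from x to all points. *)
Lemma late1P x : (forall N, late x N x = 1) <-> (forall y, hit x y = 1).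
Proof.
split=> [lx y|hx N]; last first.
  suff -> : late x N = fun=> 1 by [].
  elim: N => [|N IH]; first by apply/funext.
  by rewrite /late iterS -/(late x N) IH; apply/funext => y; exact: branch1.
suff : forall N, late x N y = 1 by move/(_ 0%N).
apply: contrapT => ny.
apply: (irreducible_ind P_ge0 P_irreducible
  (S := fun y => ~ forall N, late x N y = 1) _ x ny lx) => {y ny} z t Pzt nt zN.
apply: nt => N; apply/eqP; rewrite eq_le.
have /andP[_ ->]/= := late_unit x N t; rewrite leNgt; apply/negP => lt1.
have := zN N.+1; rewrite /late iterS -/(late x N) /branch => e.
have /andP[a0 a1] := avg01 z (late_unit x N).
have : avg (late x N) z < 1; last by move/(psi_lt1 mu_m a0); rewrite e ltxx.
have d01 : unitf (fun s => 1 - late x N s).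
  by move=> s; have /andP[? ?] := late_unit x N s; apply/andP; split; lra.
suff : avg (late x N) z + avg (fun s => 1 - late x N s) z = 1.
  have : P z t * (1 - late x N t) <= avg (fun s => 1 - late x N s) z.
    rewrite -lee_fin avgE// EFinM; apply: (mean_ge_term t (P_ge0 z)) => s.
    by rewrite lee_fin; case/andP: (d01 s).
  have : 0 < P z t * (1 - late x N t) by rewrite mulr_gt0// subr_gt0.
  lra.
apply: EFin_inj; rewrite EFinD !avgE//; last exact: late_unit.
rewrite -meanD//=.
- rewrite -[RHS](mean_cst (P_ge0 z) (@ler01 R) (P_sum z)).
  by apply: eq_mean => s _; rewrite -EFinD; congr EFin; lra.
- by move=> s; rewrite lee_fin; case/andP: (late_unit x N s).
- by move=> s; rewrite lee_fin; case/andP: (d01 s).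
Qed.

End Hitting.

(** * First passage masses *)

Section FirstPassage.
Local Open Scope ereal_scope.
Context {R : realType} {T : countType}.
Variables (P : T -> T -> R).
Hypothesis P_stochastic : stochastic P.

Let P_ge0 x y : (0 <= P x y)%R. Proof. by case: P_stochastic. Qed.
Let P_sum x : \esum_(y in [set: T]) (P x y)%:E = 1.
Proof. by case: P_stochastic. Qed.

(** The paths from y that reach x for the first time before time k, each path
    of length j counted with its probability times a^j.  For a = m this is the
    mean number of particles that are the first of their line of descent at x,
    and this before time k. *)
Fixpoint first_passage (a : R) (x : T) (k : nat) (y : T) : \bar R :=
  if k is k'.+1 then
    if y == x then 1 else a%:E * mean (P y) (first_passage a x k')
  else 0.

(** A truncation of the generating function U(x,x|a) of the first return
    probabilities. *)
Definition return_mass (a : R) (x : T) (k : nat) : \bar R :=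
  a%:E * mean (P x) (first_passage a x k).

Lemma first_passage_ge0 a x k y : (0 <= a)%R -> 0 <= first_passage a x k y.
Proof.
move=> a0; elim: k y => [|k IH] y //=; case: ifP => // _.
by rewrite mule_ge0 ?lee_fin//; apply: mean_ge0.
Qed.

Lemma first_passage_nd a x y : (0 <= a)%R ->
  nondecreasing_seq (first_passage a x ^~ y).
Proof.
move=> a0; suff H k z : first_passage a x k z <= first_passage a x k.+1 z.
  by apply/nondecreasing_seqP => k.
elim: k z => [|k IH] z; first exact: first_passage_ge0.
rewrite [leLHS]/= [leRHS]/=; case: ifP => // _.
by rewrite lee_wpmul2l ?lee_fin//; apply: le_mean => // t _; exact: IH.
Qed.

Lemma first_passage_le_pow a x k y : (0 <= a)%R ->
  first_passage a x k y <= ((1 + a) ^+ k)%:E.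
Proof.
move=> a0; elim: k y => [|k IH] y /=; first by rewrite expr0.
have a1 : (1 <= 1 + a)%R by lra.
case: ifP => _; first by rewrite lee_fin exprn_ege1.
rewrite exprS EFinM; apply: lee_pmul.
- by rewrite lee_fin.
- by apply: mean_ge0 => // z; exact: first_passage_ge0.
- by rewrite lee_fin; lra.
have pk0 : (0 <= (1 + a) ^+ k)%R by rewrite exprn_ge0//; lra.
rewrite -[leRHS](mean_cst (P_ge0 y) pk0 (P_sum y)).
by apply: le_mean => // z _; exact: IH.
Qed.

(** Paths of length less than k lose at most a factor c^k. *)
Lemma first_passage_scale a c x k y : (0 <= a)%R -> (0 <= c <= 1)%R ->
  (c ^+ k)%:E * first_passage a x k y <= first_passage (c * a) x k y.
Proof.
move=> a0 /andP[c0 c1]; elim: k y => [|k IH] y /=; first by rewrite mule0.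
case: ifP => _; first by rewrite mule1 lee_fin exprn_ile1.
rewrite exprS mulrC EFinM -muleA [X in _ <= X]/= EFinM.
rewrite -(muleA c%:E); rewrite muleCA; apply: lee_wpmul2l; first by rewrite lee_fin.
rewrite muleCA; apply: lee_wpmul2l; first by rewrite lee_fin.
rewrite -meanZ//; first exact: le_mean.
  by rewrite exprn_ge0.
by move=> z; exact: first_passage_ge0.
Qed.

Lemma return_mass_scale a c x k : (0 <= a)%R -> (0 <= c <= 1)%R ->
  (c ^+ k.+1)%:E * return_mass a x k <= return_mass (c * a) x k.
Proof.
move=> a0 /andP[c0 c1]; rewrite /return_mass exprS !EFinM -!muleA.
apply: lee_wpmul2l; first by rewrite lee_fin.
rewrite muleCA; apply: lee_wpmul2l; first by rewrite lee_fin.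
rewrite -meanZ//.
- by apply: le_mean => // z _; apply: first_passage_scale => //; rewrite c0.
- by rewrite exprn_ge0.
by move=> z; exact: first_passage_ge0.
Qed.

Lemma mean_nstep_shift a x y (r : seq nat) n : (0 <= a)%R ->
  a%:E * mean (P y) (fun z => \sum_(j <- r) (a ^+ (n + j))%:E * nstep P (n + j) z x) =
  \sum_(j <- r) (a ^+ (n.+1 + j))%:E * nstep P (n.+1 + j) y x.
Proof.
move=> a0; have aj0 j : (0 <= a ^+ j)%R by rewrite exprn_ge0.
rewrite mean_sum//; last by move=> j z; rewrite mule_ge0 ?lee_fin ?nstep_ge0.
rewrite ge0_sume_distrr; last first.
  by move=> j _; apply: mean_ge0 => // z; rewrite mule_ge0 ?lee_fin ?nstep_ge0.
apply: eq_bigr => j _; rewrite meanZ//; last by move=> z; rewrite nstep_ge0.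
by rewrite muleA -EFinM -exprS.
Qed.

Lemma first_passage_le_nstep a x k y : (0 <= a)%R ->
  first_passage a x k y <= \sum_(j <- iota 0 k) (a ^+ j)%:E * nstep P j y x.
Proof.
move=> a0; have t0 j z : 0 <= (a ^+ j)%:E * nstep P j z x.
  by rewrite mule_ge0 ?lee_fin ?exprn_ge0 ?nstep_ge0.
elim: k y => [|k IH] y /=; first by rewrite big_nil.
rewrite big_cons; case: eqP => [->|_].
  by rewrite /= eqxx expr0 mule1 leeDl// sume_ge0.
apply: le_trans (leeDr _ (t0 _ _)); rewrite -(addn0 1%N) iotaDl big_map.
rewrite -(mean_nstep_shift x y (iota 0 k) 0 a0).
rewrite lee_wpmul2l ?lee_fin//; apply: le_mean => // z _; exact: IH.
Qed.

(** Off x this holds by definition up to the monotonicity in k; at x it says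
    that the return mass has reached the value 1 of the first passage mass. *)
Lemma first_passage_subharmonic a x k y : (0 <= a)%R -> 1 <= return_mass a x k ->
  first_passage a x k y <= a%:E * mean (P y) (first_passage a x k).
Proof.
move=> a0 rm1.
apply: le_trans (first_passage_nd x y a0 (leqnSn k)) _ => /=.
by case: eqP => [->|].
Qed.

(** By subharmonicity the value 1 of [first_passage] at x survives n steps of
    the chain, but [first_passage] is at most the sum of the a^j p^(j)(.,x),
    j < k.  Hence a^n p^(n)(x,x) cannot decay. *)
Lemma return_mass_ge1_nstep a x k n : (0 <= a)%R -> 1 <= return_mass a x k ->
  1 <= \sum_(j <- iota 0 k) (a ^+ (n + j))%:E * nstep P (n + j) x x.
Proof.
move=> a0 rm1.
have F y : first_passage a x k y <=
    \sum_(j <- iota 0 k) (a ^+ (n + j))%:E * nstep P (n + j) y x.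
  elim: n y => [|n IH] y; first exact: first_passage_le_nstep.
  apply: le_trans (first_passage_subharmonic y a0 rm1) _.
  rewrite -mean_nstep_shift// lee_wpmul2l ?lee_fin//.
  by apply: le_mean => // z _; exact: IH.
apply: le_trans (F x); case: k rm1 {F} => [|k _] /=; last by rewrite eqxx.
rewrite /return_mass/= /mean esum1; last by move=> z _; rewrite mule0.
by rewrite mule0.
Qed.

Lemma return_mass_fin a x k : (0 <= a)%R -> return_mass a x k \is a fin_num.
Proof.
move=> a0; have m0 : 0 <= mean (P x) (first_passage a x k).
  by apply: mean_ge0 => // z; exact: first_passage_ge0.
rewrite ge0_fin_numE; last by rewrite mule_ge0 ?lee_fin.
apply: (@le_lt_trans _ _ (a%:E * ((1 + a) ^+ k)%:E)); last by rewrite -EFinM ltry.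
rewrite lee_wpmul2l ?lee_fin//.
have pk0 : (0 <= (1 + a) ^+ k)%R by rewrite exprn_ge0//; lra.
rewrite -[leRHS](mean_cst (P_ge0 x) pk0 (P_sum x)).
by apply: le_mean => // z _; exact: first_passage_le_pow.
Qed.

(** Multiplying the weight by c costs at most c^(k+1), and this is as close to 1
    as desired. *)
Lemma return_mass_decrease a x k : (0 < a)%R -> 1 < return_mass a x k ->
  exists2 c, (0 < c < 1)%R & 1 < return_mass (c * a) x k.
Proof.
move=> a0; have a0' := ltW a0.
rewrite -(fineK (return_mass_fin x k a0')); set b := fine _; rewrite lte_fin => b1.
pose K : R := k.+1%:R; have K0 : (0 < K)%R by rewrite ltr0n.
(* this choice makes b (1 - (k+1) d) > 1 *)
pose d := ((b - 1) / (b * (K + 1)))%R.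
have bK0 : (0 < b * (K + 1))%R by rewrite mulr_gt0//; lra.
have d0 : (0 < d)%R by rewrite divr_gt0//; lra.
have dE : (d * (b * (K + 1)) = b - 1)%R by rewrite /d divfK// gt_eqF.
have d1 : (d < 1)%R by nra.
exists (1 - d)%R; first by apply/andP; split; lra.
apply: lt_le_trans (return_mass_scale _ _ a0' _); last by apply/andP; split; lra.
rewrite -(fineK (return_mass_fin x k a0')) -/b -EFinM lte_fin.
have := @ler_subX R (1 - d) 1 k.+1; rewrite expr1n -/K.
move: ((1 - d) ^+ k.+1)%R => A h.
have {}h : (1 - A <= K * d)%R by apply: le_trans (h _ _ _) _; lra.
nra.
Qed.

(** The generating function F(y,x|a) of the first passage probabilities,
    possibly infinite. *)
Definition passage_gf (a : R) (x y : T) : \bar R :=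
  ereal_sup (range (first_passage a x ^~ y)).

Lemma cvg_passage_gf a x y : (0 <= a)%R ->
  first_passage a x ^~ y @ \oo --> passage_gf a x y.
Proof. by move=> a0; apply: ereal_nondecreasing_cvgn; exact: first_passage_nd. Qed.

Lemma first_passage_le_ratio a x k y : first_passage a x k y <= passage_gf a x y.
Proof. by apply: ereal_sup_ubound; exists k. Qed.

Lemma passage_gf_ge0 a x y : (0 <= a)%R -> 0 <= passage_gf a x y.
Proof. by move=> a0; apply: le_trans (first_passage_le_ratio a x 0 y). Qed.

Lemma passage_gf_self a x : passage_gf a x x = 1.
Proof.
apply/eqP; rewrite eq_le; apply/andP; split.
  by apply: ge_ereal_sup => _ [[|k] _ <-] //=; rewrite eqxx.
by have := first_passage_le_ratio a x 1 x; rewrite /= eqxx.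
Qed.

Lemma cvg_return_mass a x : (0 <= a)%R ->
  return_mass a x @ \oo --> a%:E * mean (P x) (passage_gf a x).
Proof.
move=> a0; apply: cvgeZl => //; apply: cvg_mean => //.
- by move=> k y; exact: first_passage_ge0.
- by move=> y; exact: first_passage_nd.
- by move=> y; exact: cvg_passage_gf.
Qed.

Lemma passage_gf_superharmonic a x y : (0 <= a)%R ->
  (forall k, return_mass a x k <= 1) ->
  a%:E * mean (P y) (passage_gf a x) <= passage_gf a x y.
Proof.
move=> a0 rm1.
have c : (fun k => a%:E * mean (P y) (first_passage a x k)) @ \oo -->
    a%:E * mean (P y) (passage_gf a x).
  apply: cvgeZl => //; apply: cvg_mean => //.
  - by move=> k z; exact: first_passage_ge0.
  - by move=> z; exact: first_passage_nd.
  - by move=> z; exact: cvg_passage_gf.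
rewrite -(cvg_lim _ c)//; apply: lime_le; first by apply/cvg_ex; eexists; exact: c.
apply: nearW => k; have [->|yx] := eqVneq y x; first by rewrite passage_gf_self; exact: rm1.
by have := first_passage_le_ratio a x k.+1 y; rewrite /= (negbTE yx).
Qed.

(** The constant c replaces w y because the latter may be infinite. *)
Lemma superharmonic_nstep a (w : T -> \bar R) c n x y : (0 <= a)%R ->
  (forall z, 0 <= w z) -> (forall z, a%:E * mean (P z) w <= w z) ->
  (0 <= c)%R -> c%:E <= w y -> (a ^+ n * c)%:E * nstep P n x y <= w x.
Proof.
move=> a0 w0 wh c0 cw; elim: n x => [|n IH] x /=.
  by rewrite expr0 mul1r; case: eqP => [->|_]; rewrite ?mule1// mule0.
apply: le_trans (wh x); rewrite exprS -mulrA EFinM -muleA; apply: lee_wpmul2l.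
  by rewrite lee_fin.
rewrite -/(mean (P x) (nstep P n ^~ y)) -meanZ//.
- by apply: le_mean => // z _; exact: IH.
- by rewrite mulr_ge0// exprn_ge0.
- by move=> z; exact: nstep_ge0.
Qed.

End FirstPassage.

(** * Return masses and the spectral radius *)

Section SpectralRadius.
Local Open Scope ereal_scope.
Context {R : realType} {T : countType}.
Variables (P : T -> T -> R).
Hypothesis P_stochastic : stochastic P.
Hypothesis P_irreducible : irreducible P.

Let P_ge0 x y : (0 <= P x y)%R. Proof. by case: P_stochastic. Qed.

Lemma spectral_radiusE x y :
  spectral_radius P x y =
  ereal_inf (range (esups (fun n => poweR (nstep P n x y) n%:R^-1))).
Proof. by rewrite /spectral_radius limn_esup_lim; apply/cvg_lim => //; exact: cvg_esups_inf. Qed.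

Lemma spectral_radius_ge0 x y : 0 <= spectral_radius P x y.
Proof.
rewrite spectral_radiusE; apply: le_ereal_inf_tmp => _ [n _ <-].
apply: (@le_trans _ _ (poweR (nstep P n x y) n%:R^-1)); first exact: poweR_ge0.
by apply: ereal_sup_ubound; exists n => /=.
Qed.

Lemma poweR_root_le (x : \bar R) (b : R) n : (0 < n)%N -> 0 <= x -> (0 <= b)%R ->
  (poweR x n%:R^-1 <= b%:E) = (x <= (b ^+ n)%:E).
Proof.
move=> n0 x0 b0; have n0' : (n%:R : R) != 0%R by rewrite pnatr_eq0 -lt0n.
case: x x0 => [r r0|_|//]; last by rewrite poweRyr ?invr_neq0// !leye_eq.
rewrite lee_fin in r0; rewrite poweR_EFin !lee_fin; apply/idP/idP => h.
  have -> : r = ((r `^ n%:R^-1) ^+ n)%R.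
    by rewrite -powR_mulrn ?powR_ge0// -powRrM mulVf// powRr1.
  by apply: lerXn2r; rewrite ?nnegrE ?powR_ge0.
have -> : b = ((b ^+ n) `^ n%:R^-1)%R.
  by rewrite -powR_mulrn// -powRrM mulfV// powRr1.
by apply: ge0_ler_powR; rewrite ?nnegrE ?exprn_ge0 ?invr_ge0.
Qed.

Lemma spectral_radius_le_inv (m : R) x : (0 < m)%R ->
  (forall n, (m ^+ n)%:E * nstep P n x x <= 1) -> m%:E <= (spectral_radius P x x)^-1.
Proof.
move=> m0 h; rewrite inve_pge ?inE ?spectral_radius_ge0 ?lee_fin ?(ltW m0)//.
rewrite inver gt_eqF// spectral_radiusE.
apply: (@le_trans _ _ (esups (fun n => poweR (nstep P n x x) n%:R^-1) 1%N)).
  by apply: ereal_inf_lbound; exists 1%N.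
apply: ge_ereal_sup => _ [n /= n1 <-].
rewrite poweR_root_le ?nstep_ge0 ?invr_ge0 ?(ltW m0)// exprVn.
by rewrite -[leRHS]mule1 lee_pdivlMl ?exprn_gt0.
Qed.

Lemma spectral_radius_lt_decay b x : (0 <= b)%R -> spectral_radius P x x < b%:E ->
  exists n0, forall n, (n0 <= n)%N -> nstep P n x x <= (b ^+ n)%:E.
Proof.
move=> b0; rewrite spectral_radiusE => /ereal_inf_lt[_ [n0 _ <-]] h.
exists n0.+1 => n n0n; rewrite -poweR_root_le ?nstep_ge0 ?(leq_ltn_trans _ n0n)//.
apply: le_trans (ltW h); apply: ereal_sup_ubound; exists n => //=.
exact: ltnW.
Qed.

(** If a return mass exceeded 1 at m, it would do so at a smaller weight c m,
    where m <= 1/rho makes (c m)^n p^(n)(x,x) decay geometrically. *)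
Lemma return_mass_le1 (m : R) x : (0 < m)%R ->
  m%:E <= (spectral_radius P x x)^-1 -> forall k, return_mass P m x k <= 1.
Proof.
move=> m0 mrho k; rewrite leNgt; apply/negP => rm1.
have [c /andP[c0 c1] {}rm1] := return_mass_decrease P_stochastic m0 rm1.
have cm0 : (0 <= c * m)%R by nra.
(* a rate strictly between 1/m >= rho and 1/(c m) *)
pose b := ((1 + c) / 2 * m)^-1%R.
have cm'0 : (0 < (1 + c) / 2 * m)%R by nra.
have b0 : (0 < b)%R by rewrite invr_gt0.
have [n0 decay] : exists n0, forall n, (n0 <= n)%N -> nstep P n x x <= (b ^+ n)%:E.
  apply: spectral_radius_lt_decay; first exact: ltW.
  apply: (@le_lt_trans _ _ (m^-1)%:E).
    have := mrho; rewrite inve_pge ?inE ?spectral_radius_ge0 ?lee_fin ?(ltW m0)//.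
    by rewrite inver gt_eqF.
  by rewrite lte_fin /b ltf_pV2 ?posrE//; nra.
pose q := (c * m * b)%R.
have q0 : (0 <= q)%R by rewrite mulr_ge0// ltW.
have q1 : (q < 1)%R by rewrite /q /b -[ltRHS](mulfV (lt0r_neq0 cm'0)) ltr_pM2r ?invr_gt0//; nra.
have [n n0n small] : exists2 n, (n0 <= n)%N & (k%:R * q ^+ n < 1)%R.
  have : (fun n => k%:R * q ^+ n)%R @ \oo --> (k%:R * 0 : R)%R.
    by apply: cvgMl_tmp; apply: cvg_expr; rewrite ger0_norm.
  rewrite mulr0 => /cvgrPdist_lt/(_ 1%R ltr01)[N _ hN].
  exists (maxn n0 N); first exact: leq_maxl.
  have := hN (maxn n0 N) (leq_maxr _ _); rewrite /= sub0r normrN ger0_norm//.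
  by rewrite mulr_ge0// exprn_ge0.
have := return_mass_ge1_nstep P_stochastic n cm0 (ltW rm1).
apply/negP; rewrite -ltNge; apply: (@le_lt_trans _ _ (k%:R * q ^+ n)%:E); last by rewrite lte_fin.
apply: (@le_trans _ _ (\sum_(j <- iota 0 k) (q ^+ n)%:E)).
  apply: lee_sum => j _.
  apply: (@le_trans _ _ (((c * m) ^+ (n + j))%:E * (b ^+ (n + j))%:E)).
    rewrite lee_wpmul2l ?lee_fin ?exprn_ge0//; apply: decay.
    by rewrite (leq_trans n0n)// leq_addr.
  rewrite -EFinM lee_fin -exprMn -/q exprD -[leRHS]mulr1.
  by rewrite ler_wpM2l ?exprn_ge0// exprn_ile1// ltW.
rewrite sumEFin lee_fin big_const_seq count_predT size_iota.
by rewrite iter_addr_0 mulr_natl.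
Qed.

Lemma passage_gf_nstep (m : R) x n y : (0 < m)%R ->
  (forall k, return_mass P m x k <= 1) ->
  (m ^+ n)%:E * nstep P n y x <= passage_gf P m x y.
Proof.
move=> m0 rm1; have m0' := ltW m0; rewrite -[(m ^+ n)%R]mulr1.
apply: (superharmonic_nstep P_stochastic) => //.
- by move=> z; exact: passage_gf_ge0.
- by move=> z; exact: (passage_gf_superharmonic P_stochastic).
- by rewrite passage_gf_self.
Qed.

(** Conversely to [return_mass_le1], [passage_gf] is m-superharmonic with value 1
    at x if no return mass exceeds 1, so m^n p^(n)(x,x) <= 1 for all n. *)
Lemma le_inv_spectral_radiusP (m : R) x : (0 < m)%R ->
  m%:E <= (spectral_radius P x x)^-1 <-> forall k, return_mass P m x k <= 1.
Proof.
move=> m0; split; first exact: return_mass_le1.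
move=> rm1; apply: spectral_radius_le_inv => // n.
by rewrite -(passage_gf_self P m x); exact: passage_gf_nstep.
Qed.

(** The m-superharmonic function [passage_gf P m x] is positive and finite by
    irreducibility; divided by its value at y it dominates the first passage
    masses to y, and superharmonicity at y bounds the return masses. *)
Lemma return_mass_le1_change_root (m : R) x y : (0 < m)%R ->
  (forall k, return_mass P m x k <= 1) -> forall k, return_mass P m y k <= 1.
Proof.
move=> m0 rm1 k; have m0' := ltW m0; pose w := passage_gf P m x.
have w0 z : 0 <= w z by exact: passage_gf_ge0.
have wh z : m%:E * mean (P z) w <= w z by exact: (passage_gf_superharmonic P_stochastic).
have wy0 : 0 < w y.
  have [n nn] := P_irreducible y x; apply: lt_le_trans (passage_gf_nstep n y m0 rm1).
  by rewrite mule_gt0// lte_fin exprn_gt0.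
have wy_fin : w y \is a fin_num.
  rewrite ge0_fin_numE//; apply: contrapT => /negP; rewrite -leNgt leye_eq => /eqP wy.
  have [n nn] := P_irreducible x y.
  have bnd c : (0 <= c)%R -> (m ^+ n * c)%:E * nstep P n x y <= 1.
    move=> c0; rewrite -(passage_gf_self P m x).
    by have := superharmonic_nstep P_stochastic n x (y := y) m0' w0 wh c0; apply; rewrite wy leey.
  have mn0 : (0 < m ^+ n)%R by rewrite exprn_gt0.
  have [r r0 rn] : exists2 r : R, (0 < r)%R & r%:E <= nstep P n x y.
    case: (nstep P n x y) nn => [r| |]//; first by rewrite lte_fin => r0; exists r.
    by exists 1%R => //; rewrite leey.
  (* with this constant the bound would read 2 <= 1 *)
  have c0 : (0 <= 2 / (m ^+ n * r))%R by rewrite divr_ge0// mulr_ge0// ltW.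
  have := bnd _ c0; apply/negP; rewrite -ltNge.
  apply: (@lt_le_trans _ _ ((m ^+ n * (2 / (m ^+ n * r)))%:E * r%:E)).
    rewrite -EFinM lte_fin mulrC mulrA [(r * _)%R]mulrC mulrCA mulfV ?mulr1 ?ltr1n//.
    by rewrite gt_eqF// mulr_gt0.
  by rewrite lee_wpmul2l// lee_fin mulr_ge0// ltW.
have wyr : w y = (fine (w y))%:E by rewrite fineK.
have wyr0 : (0 < fine (w y))%R by rewrite -lte_fin -wyr.
have fpw j z : (fine (w y))%:E * first_passage P m y j z <= w z.
  elim: j z => [|j IH] z /=; first by rewrite mule0.
  case: eqP => [->|_]; first by rewrite mule1 -wyr.
  apply: le_trans (wh z); rewrite muleCA lee_wpmul2l ?lee_fin// -meanZ ?(ltW wyr0)//.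
  - exact: le_mean.
  - by move=> t; exact: first_passage_ge0.
rewrite -(lee_pmul2l (x := w y))// mule1; apply: le_trans (wh y).
rewrite /return_mass muleCA lee_wpmul2l ?lee_fin// wyr -meanZ ?(ltW wyr0)//.
- exact: le_mean.
- by move=> t; exact: first_passage_ge0.
Qed.

End SpectralRadius.

(** * Extinction up to the critical mean, survival above it *)

Section Recurrence.
Local Open Scope ereal_scope.
Context {R : realType} {T : countType}.
Variables (P : T -> T -> R) (mu : nat -> R) (m : R).
Hypothesis P_stochastic : stochastic P.
Hypothesis mu_m : offspring_distribution mu m.

Let P_ge0 x y : (0 <= P x y)%R. Proof. by case: P_stochastic. Qed.
Let m1 : (1 <= m)%R. Proof. exact: mean_offspring_ge1 mu_m. Qed.
Let m0 : (0 <= m)%R. Proof. exact: le_trans m1. Qed.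
Local Notation branch := (branch P mu).
Local Notation hit_before := (hit_before P mu).
Local Notation hit := (hit P mu).
Local Notation late := (late P mu).
Local Notation avg := (avg P).

(** Union bound over the children, m of them in the mean. *)
Lemma branch_le_mean u y : unitf u ->
  (branch u y)%:E <= m%:E * mean (P y) (EFin \o u).
Proof.
move=> u01; have /andP[a0 a1] := avg01 P_stochastic y u01.
by rewrite -(avgE P_stochastic y u01) -EFinM lee_fin; exact: (psi_le mu_m).
Qed.

Lemma hit_before_le_first_passage x k y :
  (hit_before x k y)%:E <= first_passage P m x k y.
Proof.
elim: k y => [|k IH] y //=; case: ifP => // _.
apply: le_trans (branch_le_mean _ (hit_before_unit P_stochastic mu_m x k)) _.
by rewrite lee_wpmul2l ?lee_fin//; apply: le_mean => // z _; exact: IH.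
Qed.

Lemma hit_le_passage_gf x y : (hit x y)%:E <= passage_gf P m x y.
Proof.
have c : (fun k => (hit_before x k y)%:E) @ \oo --> (hit x y)%:E.
  apply: cvg_EFin; first exact: nearW.
  exact: (cvg_hit P_stochastic mu_m).
rewrite -(cvg_lim _ c)//; apply: lime_le; first by apply/cvg_ex; eexists; exact: c.
apply: nearW => k; apply: le_trans (hit_before_le_first_passage x k y) _.
exact: first_passage_le_ratio.
Qed.

(** A visit of x at time >= N + k comes from a first visit of x, either before
    time k, which then has to be followed by a visit N or more steps later, or
    not before time k, of which there are F - F_k in the mean.  The term F_k is
    on the left since F may be infinite. *)
Lemma late_le_passage_gf x N k y : (forall j, return_mass P m x j <= 1) ->
  (late x (N + k) y)%:E + first_passage P m x k y <=
  passage_gf P m x y + (late x N x)%:E * first_passage P m x k y.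
Proof.
move=> rm1; have lu := late_unit P_stochastic mu_m x.
have fp0 j z : 0 <= first_passage P m x j z by exact: first_passage_ge0.
have gr0 z : 0 <= passage_gf P m x z by exact: passage_gf_ge0.
have l0 j z : 0 <= (late x j z)%:E by rewrite lee_fin; case/andP: (lu j z).
elim: k y => [|k IH] y.
  rewrite /= mule0 !adde0; apply: le_trans (hit_le_passage_gf x y).
  by rewrite lee_fin; exact: (late_ni P_stochastic mu_m x y (leq0n _)).
have [->|yx] := eqVneq y x.
  rewrite passage_gf_self /= eqxx mule1 addeC leeD2l// lee_fin.
  by apply: (late_ni P_stochastic mu_m x x); exact: leq_addr.
rewrite addnS [late x _.+1 y]/(branch (late x (N + k)) y) /= (negbTE yx).
apply: (@le_trans _ _ (m%:E * mean (P y) (EFin \o late x (N + k)) +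
                       m%:E * mean (P y) (first_passage P m x k))).
  by rewrite leeD2r//; exact: branch_le_mean.
have /andP[lN0 _] := lu N x.
rewrite muleCA -(meanZ (c := late x N x))//.
rewrite -ge0_muleDr; [|exact: mean_ge0 (P_ge0 y) (l0 _)|exact: mean_ge0 (P_ge0 y) (fp0 _)].
rewrite -meanD//; [|exact: l0].
apply: (@le_trans _ _ (m%:E * mean (P y) (fun z => passage_gf P m x z +
                         (late x N x)%:E * first_passage P m x k z))).
  by rewrite lee_wpmul2l ?lee_fin//; apply: le_mean => // z _; exact: IH.
have lfp0 z : 0 <= (late x N x)%:E * first_passage P m x k z by rewrite mule_ge0.
rewrite meanD// ge0_muleDr; [|exact: mean_ge0 (P_ge0 y) gr0|exact: mean_ge0 (P_ge0 y) lfp0].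
by rewrite leeD2r//; exact: (passage_gf_superharmonic P_stochastic).
Qed.

(** Let l be the limit of [late x N x].  Inserting [late_le_passage_gf] at the
    children of x and letting k, then N tend to infinity gives
    l <= psi (l U / m) with U <= 1, while psi s < m s for s > 0.  So l = 0.  The
    limits are replaced by errors eta adding up to less than the gap
    between psi (l / m) and l. *)
Lemma critical_extinction x : (1 < m)%R -> (forall k, return_mass P m x k <= 1) ->
  (late x ^~ x @ \oo --> (0 : R))%R.
Proof.
move=> m_gt1 rm1; have lu := late_unit P_stochastic mu_m x.
have ni := late_ni P_stochastic mu_m x x.
have hlb : has_lbound (range (late x ^~ x)).
  by exists 0%R => _ [N _ <-]; case/andP: (lu N x).
have cl := nonincreasing_cvgn ni hlb.
set l := inf _ in cl; suff -> : 0%R = l by [].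
have l_le N : (l <= late x N x)%R by apply: ge_inf => //; exists N.
have l0 : (0 <= l)%R.
  by apply: lb_le_inf; [exists (late x 0 x), 0%N|move=> _ [N _ <-]; case/andP: (lu N x)].
have l1 : (l <= 1)%R by apply: le_trans (l_le 0%N) _; case/andP: (lu 0%N x).
apply/eqP; rewrite eq_le l0/= leNgt; apply/negP => lgt0.
have mgt0 : (0 < m)%R by exact: lt_le_trans m1.
pose s := (l / m)%R.
have sm : (m * s = l)%R by rewrite /s mulrC divfK// gt_eqF.
have s0 : (0 < s)%R by rewrite divr_gt0.
have s1 : (s <= 1)%R by rewrite /s ler_pdivrMr// mul1r; lra.
have psl : (psi mu s < l)%R by rewrite -sm; exact: (psi_lt mu_m).
pose eta := ((l - psi mu s) / 3)%R.
have eta0 : (0 < eta)%R by rewrite /eta divr_gt0//; lra.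
have [N lN] : exists N, (late x N x <= l + eta)%R.
  have /cvgrPdist_lt/(_ _ eta0)[N _ hN] := cl; exists N.
  have := hN N (leqnn N); rewrite /= distrC ger0_norm ?subr_ge0//; lra.
pose U := fine (m%:E * mean (P x) (passage_gf P m x)).
have UE : U%:E = m%:E * mean (P x) (passage_gf P m x).
  rewrite fineK// ge0_fin_numE; last first.
    rewrite mule_ge0 ?lee_fin//; apply: mean_ge0 => // z; exact: passage_gf_ge0.
  apply: (@le_lt_trans _ _ 1); last exact: ltry.
  by rewrite -(passage_gf_self P m x); exact: (passage_gf_superharmonic P_stochastic).
pose r k := fine (return_mass P m x k).
have rE k : (r k)%:E = return_mass P m x k.
  by rewrite fineK//; exact: (return_mass_fin P_stochastic).
have U1 : (U <= 1)%R.
  rewrite -lee_fin UE -[leRHS](passage_gf_self P m x).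
  exact: (passage_gf_superharmonic P_stochastic).
have [k rk] : exists k, (U <= r k + eta)%R.
  have := cvg_return_mass P_stochastic (x := x) m0; rewrite -UE => /fine_cvg/cvgrPdist_lt.
  move=> /(_ _ eta0)[k _ hk]; exists k.
  have := hk k (leqnn k); rewrite /= -/(r k) => /ltr_normlW; lra.
have rk1 : (r k <= 1)%R by rewrite -lee_fin rE.
have rk0 : (0 <= r k)%R.
  rewrite -lee_fin rE mule_ge0 ?lee_fin//; apply: mean_ge0 => // z.
  exact: first_passage_ge0.
pose b := avg (late x (N + k)) x.
have /andP[b0 b1] : (0 <= b <= 1)%R by exact: (avg01 P_stochastic).
have bE : (m * b + r k <= U + late x N x * r k)%R.
  have fp0 z : 0 <= first_passage P m x k z by exact: first_passage_ge0.
  have gr0 z : 0 <= passage_gf P m x z by exact: passage_gf_ge0.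
  have l0' z : 0 <= (EFin \o late x (N + k)) z by rewrite lee_fin; case/andP: (lu (N + k)%N z).
  have lfp0 z : 0 <= (late x N x)%:E * first_passage P m x k z.
    by rewrite mule_ge0// lee_fin; case/andP: (lu N x).
  rewrite -lee_fin !EFinD EFinM (avgE P_stochastic)// UE EFinM rE.
  have /andP[lN0 _] := lu N x.
  rewrite /return_mass muleCA -(meanZ (c := late x N x))//.
  rewrite -!ge0_muleDr; try exact: mean_ge0.
  rewrite -!meanD// lee_wpmul2l ?lee_fin//; apply: le_mean => // z _.
  exact: late_le_passage_gf.
have lb : (l <= psi mu b)%R by exact: l_le (N + k).+1.
have /andP[LN0 LN1] := lu N x.
have mb : (m * b <= l + eta + eta)%R by nra.
have [bs|sb] := leP b s.
  by have := psi_mono mu_m b0 bs s1; lra.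
have := psi_lipschitz mu_m (ltW s0) (ltW sb) b1.
rewrite mulrBr sm; rewrite /eta in mb; lra.
Qed.

(** The probability that the branching chain started at y visits x at one of the
    times N, ..., N+k-1. *)
Definition visit (x : T) (N k : nat) : T -> R := iter N branch (hit_before x k).

Lemma visit_unit x N k : unitf (visit x N k).
Proof.
elim: N => [|N IH]; first exact: (hit_before_unit P_stochastic mu_m).
exact: (branch_unit P_stochastic mu_m).
Qed.

Lemma visit_nd x N y : nondecreasing_seq (fun k => visit x N k y).
Proof.
elim: N y => [|N IH] y; first exact: (hit_before_nd P_stochastic mu_m).
move=> k l kl; apply: (branch_mono P_stochastic mu_m); try exact: visit_unit.
by move=> z; exact: IH.
Qed.

Lemma cvg_visit x N y : ((fun k => visit x N k y) @ \oo --> late x N y)%R.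
Proof.
elim: N y => [|N IH] y; first exact: (cvg_hit P_stochastic mu_m).
apply: (cvg_branch P_stochastic mu_m).
- by move=> k; exact: visit_unit.
- exact: (late_unit P_stochastic mu_m).
- by move=> z; exact: visit_nd.
- exact: IH.
Qed.

Lemma visit_le_nstep x N k y : m = 1%R ->
  (visit x N k y)%:E <= \sum_(j <- iota 0 k) nstep P (N + j) y x.
Proof.
move=> mE; have aE j z : (1 ^+ (j : nat))%:E * nstep P j z x = nstep P j z x.
  by rewrite expr1n mul1e.
elim: N y => [|N IH] y.
  apply: le_trans (hit_before_le_first_passage x k y) _; rewrite mE.
  apply: le_trans (first_passage_le_nstep P_stochastic x k y ler01) _.
  by under eq_bigr do rewrite aE.
apply: le_trans (branch_le_mean y (visit_unit x N k)) _.
under eq_bigr do rewrite -aE.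
rewrite -(mean_nstep_shift P_stochastic x y _ _ (@ler01 R)) mE !mul1e.
apply: le_mean => // z _; apply: le_trans (IH z) _.
by under [leRHS]eq_bigr do rewrite aE.
Qed.

(** For m = 1 there is one particle, and [late x N x] is at most the tail of the
    convergent series of the p^(n)(x,x). *)
Lemma transient_extinction x : m = 1%R -> transient P ->
  (late x ^~ x @ \oo --> (0 : R))%R.
Proof.
move=> mE tr; have lu := late_unit P_stochastic mu_m x.
have lle N : (late x N x)%:E <= \sum_(N <= j <oo) nstep P j x x.
  have c : (fun k => (visit x N k x)%:E) @ \oo --> (late x N x)%:E.
    by apply: cvg_EFin; [exact: nearW|exact: cvg_visit].
  rewrite -(cvg_lim _ c)//; apply: lime_le; first by apply/cvg_ex; eexists; exact: c.
  apply: nearW => k; apply: le_trans (visit_le_nstep x N k x mE) _.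
  apply: le_trans; last first.
    by apply: (nneseries_lim_ge (N + k)) => j _ _; exact: nstep_ge0.
  by rewrite /index_iota addKn -{2}(addn0 N) iotaDl big_map.
have := nneseries_tail_cvg (tr x x) (fun j _ => nstep_ge0 P_ge0 j x x).
move=> tail; apply: (@fine_cvg _ _ _ _ (fun N => (late x N x)%:E)).
apply: (squeeze_cvge _ (cvg_cst _) tail).
by apply: nearW => N; rewrite lle andbT lee_fin; case/andP: (lu N x).
Qed.

Lemma branch_growth (a e : R) (u : T -> R) (v : T -> \bar R) y :
  (forall t, (0 <= t -> t <= 1 -> a * Num.min t e <= psi mu t)%R) ->
  (0 <= a)%R -> (0 <= e)%R -> unitf u -> (forall z, 0 <= v z) ->
  (forall z, v z <= e%:E) -> (forall z, v z <= (u z)%:E) ->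
  a%:E * mean (P y) v <= (branch u y)%:E.
Proof.
move=> slope a0 e0 u01 v0 ve vu.
have /andP[s0 s1] := avg01 P_stochastic y u01.
apply: (@le_trans _ _ (a * Num.min (avg u y) e)%:E); last by rewrite lee_fin slope.
rewrite EFinM lee_wpmul2l ?lee_fin// EFin_min le_min (avgE P_stochastic)//.
apply/andP; split; first by apply: le_mean => // z _; exact: vu.
rewrite -[leRHS](mean_cst (P_ge0 y) e0 (P_stochastic.2 y)).
exact: le_mean.
Qed.

(** The linear growth rate of [branch] at 0 is m by [psi_slope].  So for some
    a < m which still has a return mass above 1, [branch] dominates the linear
    operator of rate a on all small multiples of [first_passage P a x]; small
    means below e, uniformly in j <= k since [first_passage] is bounded. *)
Lemma supercritical_seed x k : 1 < return_mass P m x k ->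
  exists a e : R, [/\ (0 <= a)%R, (0 < e <= 1)%R, 1 < return_mass P a x k &
    forall u c j y, unitf u -> (0 <= c <= e)%R -> (j <= k)%N ->
      (forall z, c%:E * first_passage P a x j z <= (u z)%:E) ->
      c%:E * (a%:E * mean (P y) (first_passage P a x j)) <= (branch u y)%:E].
Proof.
move=> rm1; have mgt0 : (0 < m)%R by exact: lt_le_trans m1.
have [c /andP[c0 c1] {}rm1] := return_mass_decrease P_stochastic mgt0 rm1.
set a := (c * m)%R in rm1; have a0 : (0 <= a)%R by rewrite mulr_ge0// ltW.
have am : (a < m)%R by rewrite /a; nra.
have [e0 e00 slope] := psi_slope mu_m a0 am.
pose B := ((1 + a) ^+ k)%R; have B0 : (0 < B)%R by rewrite exprn_gt0//; lra.
pose e := Num.min 1%R (e0 / B)%R.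
have egt0 : (0 < e)%R by rewrite lt_min ltr01 divr_gt0.
have e1 : (e <= 1)%R by rewrite ge_min lexx.
exists a, e; split=> //; first by rewrite egt0.
move=> u d j y u01 /andP[d0 de] jk du.
have fp0 z : 0 <= first_passage P a x j z by exact: first_passage_ge0.
rewrite muleCA -(meanZ (c := d))//.
apply: (branch_growth y slope a0 (ltW e00) u01 _ _ du) => z.
  by rewrite mule_ge0.
apply: (@le_trans _ _ (d%:E * B%:E)).
  rewrite lee_wpmul2l ?lee_fin//.
  apply: le_trans (first_passage_le_pow P_stochastic x k z a0).
  by apply: (first_passage_nd P_stochastic x z a0).
rewrite -EFinM lee_fin -ler_pdivlMr//; apply: le_trans de _.
by rewrite ge_min lexx orbT.
Qed.

(** If 0 < g x < e, then g dominates g x times [first_passage], and one more step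
    at x multiplies g x by a return mass above 1, a contradiction.  The
    threshold e being the same for all g makes it invariant under
    automorphisms. *)
Lemma supersolution_lower_bound x k : 1 < return_mass P m x k ->
  exists2 e : R, (0 < e)%R & forall g, unitf g -> (forall z, branch g z <= g z)%R ->
    (0 < g x -> e <= g x)%R.
Proof.
move=> /supercritical_seed[a [e [a0 /andP[e0 e1] rm1 grow]]].
exists e => // g g01 gs gx0; rewrite leNgt; apply/negP => gxe.
have gx_e : (0 <= g x <= e)%R by rewrite !ltW.
have wg j z : (j <= k)%N -> (g x)%:E * first_passage P a x j z <= (g z)%:E.
  elim: j z => [|j IH] z jk /=; first by rewrite mule0 lee_fin; case/andP: (g01 z).
  case: eqP => [->|_]; first by rewrite mule1.
  apply: (@le_trans _ _ (branch g z)%:E); last by rewrite lee_fin; exact: gs.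
  by apply: grow => //; [exact: ltnW|move=> t; apply: IH; exact: ltnW].
suff : (g x)%:E < (g x)%:E by rewrite ltxx.
apply: (@lt_le_trans _ _ (branch g x)%:E); last by rewrite lee_fin; exact: gs.
apply: lt_le_trans (grow g (g x) k x g01 gx_e (leqnn k) _); last by move=> z; exact: wg.
by rewrite -[ltLHS]mule1 lte_pmul2l ?lte_fin.
Qed.

(** By [supercritical_seed], e times [first_passage] is a subsolution below
    [hit x], hence below all its images under [branch]. *)
Lemma supercritical_survival x k : 1 < return_mass P m x k ->
  exists2 e : R, (0 < e)%R & forall N, (e <= late x N x)%R.
Proof.
move=> /supercritical_seed[a [e [a0 /andP[e0 e1] rm1 grow]]].
have e_e : (0 <= e <= e)%R by rewrite lexx ltW.
have lu := late_unit P_stochastic mu_m x.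
have wh j z : (j <= k)%N -> e%:E * first_passage P a x j z <= (hit x z)%:E.
  elim: j z => [|j IH] z jk /=.
    by rewrite mule0 lee_fin; case/andP: (hit_unit P_stochastic mu_m x z).
  case: eqP => [->|/eqP zx]; first by rewrite (hit_self P_stochastic mu_m) mule1 lee_fin.
  rewrite (hit_step P_stochastic mu_m zx); apply: grow => //; last 2 first.
  - exact: ltnW.
  - by move=> t; apply: IH; exact: ltnW.
  exact: (hit_unit P_stochastic mu_m).
have wl N z : e%:E * first_passage P a x k z <= (late x N z)%:E.
  elim: N z => [|N IH] z; first exact: wh.
  apply: le_trans (grow _ _ k z (lu N) e_e (leqnn k) IH).
  rewrite lee_wpmul2l ?lee_fin ?(ltW e0)//.
  by apply: (first_passage_subharmonic P_stochastic) => //; exact: ltW.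
exists e => // N; rewrite -lee_fin; apply: le_trans (wl N x).
case: k rm1 {grow wh wl} => [|k _]; last by rewrite /= eqxx mule1.
move=> rm1; suff : return_mass P a x 0 = 0 by move=> rm0; move: rm1; rewrite rm0 lte_fin ltr10.
by rewrite /return_mass /mean esum1 ?mule0// => z _; rewrite mule0.
Qed.

End Recurrence.

(** * Strong recurrence of quasi-transitive chains *)

Section StrongRecurrence.
Context {R : realType} {T : countType}.
Variables (E : rel T) (P : T -> T -> R) (mu : nat -> R) (m : R).
Hypothesis P_stochastic : stochastic P.
Hypothesis P_irreducible : irreducible P.
Hypothesis mu_m : offspring_distribution mu m.
Hypothesis P_quasi_transitive : quasi_transitive E P.

Definition threshold (y : T) (e : R) : Prop :=
  forall g, unitf g -> (forall z, branch P mu g z <= g z) -> 0 < g y -> e <= g y.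

Lemma branch_AUT (h : T -> T) (g : T -> R) y : AUT E P h ->
  branch P mu (g \o h) y = branch P mu g (h y).
Proof.
case=> bij_h _ hP; congr (psi mu (fine _)).
rewrite /mean [RHS](reindex_esum [set: T] [set: T] h) ?setTT_bijective//.
by apply: eq_esum => z _; rewrite hP.
Qed.

Lemma threshold_AUT y e (h : T -> T) : AUT E P h -> threshold y e -> threshold (h y) e.
Proof.
move=> Eh ye g g01 gs gy; apply: (ye (g \o h)) => // [z|z]; first exact: g01.
by rewrite branch_AUT//; exact: gs.
Qed.

Lemma AUT_orbit_refl y : AUT_orbit E P y y.
Proof. by exists id => //; split => //; exists id. Qed.

(** A threshold at y serves the whole orbit of y, and there are finitely many
    orbits. *)
Lemma quasi_transitive_uniform :
  (forall y, exists2 e, 0 < e & threshold y e) ->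
  exists2 e, 0 < e & forall y, threshold y e.
Proof.
move=> pointwise; case: P_quasi_transitive => _ _ _ /finite_seqP[s sE].
suff [e e0 he] : exists2 e, 0 < e &
    forall y, AUT_orbit E P y \in s -> threshold y e.
  exists e => // y; apply: he.
  by have : [set` s] (AUT_orbit E P y) by rewrite -sE; exists y.
elim: s {sE} => [|O s [e e0 IH]]; first by exists 1.
have [[y0 y0O]|nO] := pselect (exists y, AUT_orbit E P y = O); last first.
  exists e => // y; rewrite in_cons => /orP[/eqP yO|]; last exact: IH.
  by case: nO; exists y.
have [e' e'0 he'] := pointwise y0.
exists (Num.min e e'); first by rewrite lt_min e0.
move=> y; rewrite in_cons => /orP[/eqP yO|ys] g g01 gs gy.
  have [h hE yh] : AUT_orbit E P y0 y by rewrite y0O -yO; exact: AUT_orbit_refl.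
  rewrite -yh in gy *; apply: le_trans (threshold_AUT hE he' g01 gs gy).
  by rewrite ge_min lexx orbT.
by apply: le_trans (IH y ys g g01 gs gy); rewrite ge_min lexx.
Qed.

(** The function [hit P mu x] is a positive solution of branch g <= g, hence
    bounded below, hence 1. *)
Lemma strong_recurrence x : 1 < m -> ((spectral_radius P x x)^-1 < m%:E)%E ->
  forall y, hit P mu x y = 1.
Proof.
move=> m1 rho_m; have m0 : 0 < m by lra.
have [e e0 he] : exists2 e, 0 < e & forall y, threshold y e.
  apply: quasi_transitive_uniform => y.
  have [k rmk] : exists k, (1 < return_mass P m y k)%E.
    apply: contrapT => nk; move: rho_m; apply/negP; rewrite -leNgt.
    apply/(le_inv_spectral_radiusP P_stochastic x m0).
    apply: (return_mass_le1_change_root P_stochastic P_irreducible (x := y)) => // k.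
    by rewrite leNgt; apply/negP => rmk; apply: nk; exists k.
  exact: (supersolution_lower_bound P_stochastic mu_m rmk).
have hu := hit_unit P_stochastic mu_m x.
have hs := branch_hit_le P_stochastic mu_m x.
apply: (supersolution_eq1 P_stochastic mu_m m1 hu hs e0) => y.
by apply: he => //; exact: (hit_gt0 P_stochastic mu_m P_irreducible).
Qed.

End StrongRecurrence.

(** * Chains connected at a common root *)

Section Glued.
Context {R : realType} {I : countType} {X : I -> countType}.
Variables (r : forall i, X i) (P : forall i, X i -> X i -> R) (a : I -> R).
Local Notation Y := (glued r).
Local Notation Q := (glued_chain r P a).

Definition glue i (z : X i) : Y :=
  if insub z is Some u then Some (Tagged (fun i => {x : X i | x != r i}) u) else None.
Arguments glue : clear implicits.

Lemma glue_root i : glue i (r i) = None.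
Proof. by rewrite /glue insubF// eqxx. Qed.

Lemma glue_val (u : {i : I & {x : X i | x != r i}}) :
  glue (tag u) (val (tagged u)) = Some u.
Proof. by rewrite /glue valK; case: u. Qed.

Lemma glue_eq_root i z : (glue i z == None) = (z == r i).
Proof. by rewrite /glue; case: insubP => [u zr _|/negPn/eqP->]; rewrite ?eqxx// (negbTE zr). Qed.

Lemma glue_inj i : injective (glue i).
Proof.
move=> z z'; rewrite /glue; case: insubP => [u _ <-|/negPn/eqP->];
  case: insubP => [u' _ <-|/negPn/eqP->] // [].
by move=> e; rewrite (eq_from_Tagged e).
Qed.

Lemma glued_ind (S : Y -> Prop) : S None -> (forall i z, S (glue i z)) -> forall y, S y.
Proof. by move=> SN Sg [u|//]; rewrite -glue_val. Qed.

Lemma glued_chain_glue i x z : x != r i -> Q (glue i x) (glue i z) = P x z.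
Proof.
move=> xr; rewrite {1}/glue insubT /= /glue.
by case: insubP => [u _ <-|/negPn/eqP->]; rewrite ?eqxx ?tagged_asE.
Qed.

Lemma glued_chain_root i z : z != r i -> Q None (glue i z) = a i * P (r i) z.
Proof. by move=> zr; rewrite /glue insubT. Qed.

(** Away from the root, a particle in X i moves as under P i. *)
Lemma mean_glued i (x : X i) (G : Y -> \bar R) : x != r i ->
  mean (Q (glue i x)) G = mean (P x) (G \o glue i).
Proof.
move=> xr; rewrite /mean (@esum_supported _ _ (glue i @` [set: X i])); last first.
  move=> y ny; rewrite (_ : Q _ _ = 0) ?mul0e//.
  rewrite {1}/glue insubT/=; case: y ny => [v|] ny; last first.
    by case: ny; exists (r i); rewrite ?glue_root.
  case: eqP => // iv; case: ny; case: v iv => j v /= iv; subst j.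
  by exists (val v) => //; rewrite (glue_val (Tagged _ v)).
rewrite esum_image; last by move=> z z' _ _; exact: glue_inj.
by apply: eq_esum => z _; rewrite glued_chain_glue.
Qed.

Lemma esum_glued (F : Y -> \bar R) : (forall y, 0 <= F y)%E ->
  (\esum_(y in [set: Y]) F y =
   F None + \esum_(i in [set: I]) \esum_(z in [set z | z != r i]) F (glue i z))%E.
Proof.
move=> F0; rewrite (esumID [set (None : Y)])//; congr (_ + _)%E.
  by rewrite setTI esum_set1.
pose J i := glue i @` [set z | z != r i].
under [in RHS]eq_esum => i _.
  rewrite -(esum_image _ (glue i)); last by move=> z z' _ _; exact: glue_inj.
  over.
rewrite (esum_esum (J := J)); last by [].
rewrite (reindex_esum [set: {i : I & {x : X i | x != r i}}] _
  (fun u => (tag u, Some u : Y))); last first.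
  split=> [u _|u v _ _ [_ ->]//|[i y] [_ [z /= zr <-]]].
    by split => //=; exists (val (tagged u)); [exact: (valP (tagged u))|exact: glue_val].
  by exists (Tagged (fun i => {x : X i | x != r i}) (Sub z zr : {x | x != r i})) => //;
    rewrite /glue insubT.
rewrite (_ : _ `&` _ = Some @` [set: {i : I & {x : X i | x != r i}}]).
  by rewrite esum_image// => u v _ _ [].
apply/seteqP; split=> [[u [_ _]|[_ /=]//]|_ [u _ <-]//].
by exists u.
Qed.

Hypothesis P_stochastic : forall i, stochastic (@P i).
Hypothesis a_weights : root_weights a.

Let P_ge0 i (x y : X i) : 0 <= P x y. Proof. by case: (P_stochastic i). Qed.
Let a_ge0 i : 0 <= a i. Proof. by case: a_weights => + _ => /(_ i)/ltW. Qed.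

Lemma glued_chain_loop :
  (Q None None)%:E = (\esum_(i in [set: I]) (a i * P (r i) (r i))%:E)%E.
Proof.
rewrite /= fineK// ge0_fin_numE; last first.
  by apply: esum_ge0 => i _; rewrite lee_fin mulr_ge0.
apply: (@le_lt_trans _ _ (1 : R)%:E); last exact: ltry.
rewrite -[leRHS](a_weights.2); apply: le_esum => i _; rewrite lee_fin ler_piMr//.
rewrite -lee_fin -((P_stochastic i).2 (r i)).
have one_ge0 : forall z : X i, (0 <= (1 : \bar R))%E by move=> _; exact: lee01.
have := mean_ge_term (r i) (P_ge0 (r i)) one_ge0.
by rewrite /mean; under eq_esum do rewrite mule1; rewrite mule1.
Qed.

Lemma glued_chain_ge0 x y : 0 <= Q x y.
Proof.
case: x => [u|]; case: y => [v|] /=.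
- by case: ifP.
- exact: P_ge0.
- by rewrite mulr_ge0.
- rewrite fine_ge0//; apply: esum_ge0 => i _; rewrite lee_fin mulr_ge0//.
Qed.

Lemma glued_stochastic : stochastic Q.
Proof.
split; first exact: glued_chain_ge0.
move=> x; case: x => [u|]; last first.
  rewrite esum_glued; last by move=> y; rewrite lee_fin glued_chain_ge0.
  rewrite glued_chain_loop -esumD; last 2 first.
  - by move=> i _; rewrite lee_fin mulr_ge0.
  - by move=> i _; apply: esum_ge0 => z _; rewrite lee_fin glued_chain_ge0.
  rewrite -[RHS](a_weights.2); apply: eq_esum => i _.
  transitivity ((a i)%:E * \esum_(z in [set: X i]) (P (r i) z)%:E)%E; last first.
    by rewrite (P_stochastic i).2 mule1.
  rewrite -esumZ//; last by move=> z; rewrite lee_fin.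
  rewrite [RHS](esumID [set r i]); last by move=> z _; rewrite -EFinM lee_fin mulr_ge0.
  rewrite setTI esum_set1; last by rewrite -EFinM lee_fin mulr_ge0.
  congr (_ + _)%E.
  rewrite (_ : _ `&` _ = [set z | z != r i]); last first.
    by apply/seteqP; split=> [z [_ /= /eqP]|z /= /eqP].
  by apply: eq_esum => z zr; rewrite glued_chain_root.
rewrite -glue_val; have ur := valP (tagged u).
transitivity (mean (Q (glue (tag u) (val (tagged u)))) (fun=> 1%E)).
  by apply: eq_esum => y _; rewrite mule1.
rewrite mean_glued//; apply: mean_cst => //; exact: (P_stochastic _).2.
Qed.

Hypothesis P_irreducible : forall i, irreducible (@P i).

Lemma glued_irreducible : irreducible Q.
Proof.
apply: (ind_irreducible glued_chain_ge0) => S SQ.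
have SX i z z' : S (glue i z') -> S (glue i z).
  apply: (irreducible_ind (@P_ge0 i) (@P_irreducible i) (S := S \o glue i)) => x y Pxy /= Sy.
  have [xr|xr] := eqVneq x (r i); last by apply: SQ Sy; rewrite glued_chain_glue.
  rewrite xr glue_root; have [yr|yr] := eqVneq y (r i).
    by rewrite -(glue_root i) -yr.
  by apply: SQ Sy; rewrite glued_chain_root// mulr_gt0 ?(a_weights.1 i)// -xr.
move=> x y Sy.
have SN : S None.
  by case: y Sy => [u|//]; rewrite -glue_val -(glue_root (tag u)); exact: SX.
by elim/glued_ind: x => [//|i z]; apply: (SX i _ (r i)); rewrite glue_root.
Qed.

Variable mu : nat -> R.

Lemma hit_before_glued k i z :
  hit_before Q mu None k (glue i z) = hit_before (@P i) mu (r i) k z.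
Proof.
elim: k z => [|k IH] z //=; rewrite glue_eq_root; case: eqP => // /eqP zr.
congr (psi mu (fine _)); rewrite mean_glued//; apply: eq_mean => y _ /=.
by rewrite IH.
Qed.

(** The process in X i may leave X i only through the root. *)
Lemma hit_glued i z : hit Q mu None (glue i z) = hit (@P i) mu (r i) z.
Proof. by congr (limn _); apply/funext => k; exact: hit_before_glued. Qed.

End Glued.

(** * The law of the branching chain *)

Section EsumLists.
Local Open Scope ereal_scope.
Context {R : realType}.

Lemma esum_pair {A B : choiceType} (f : A -> B -> \bar R) :
  (forall x y, 0 <= f x y) ->
  \esum_(x in [set: A]) \esum_(y in [set: B]) f x y =
  \esum_(p in [set: A * B]) f p.1 p.2.
Proof.
move=> f0; rewrite esum_esum//; congr (esum _ _).
by apply/seteqP; split.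
Qed.

Lemma esum_prod {A B : choiceType} (f : A -> R) (g : B -> R) (b : R) :
  (forall x, 0 <= f x)%R -> (forall y, 0 <= g y)%R ->
  \esum_(y in [set: B]) (g y)%:E = b%:E ->
  \esum_(p in [set: A * B]) (f p.1 * g p.2)%:E =
  b%:E * \esum_(x in [set: A]) (f x)%:E.
Proof.
move=> f0 g0 gb; rewrite -(esum_pair (f := fun x y => (f x * g y)%:E)); last first.
  by move=> x y; rewrite lee_fin mulr_ge0.
have b0 : (0 <= b)%R by rewrite -lee_fin -gb; apply: esum_ge0 => y _; rewrite lee_fin.
rewrite -esumZ//.
apply: eq_esum => x _; under eq_esum do rewrite EFinM.
by rewrite esumZ ?gb 1?muleC// => y; rewrite lee_fin.
Qed.

Lemma esum_size {T : countType} (w : T -> R) (b : R) k :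
  (forall z, 0 <= w z)%R -> \esum_(z in [set: T]) (w z)%:E = b%:E ->
  \esum_(l in [set l : seq T | size l = k]) (\prod_(z <- l) w z)%:E = (b ^+ k)%:E.
Proof.
move=> w0 wb; have p0 (l : seq T) : (0 <= \prod_(z <- l) w z)%R by exact: prodr_ge0.
have b0 : (0 <= b)%R by rewrite -lee_fin -wb; apply: esum_ge0 => y _; rewrite lee_fin.
elim: k => [|k IH].
  rewrite (_ : mkset _ = [set [::]]); last by apply/seteqP; split=> -[].
  by rewrite esum_set1 big_nil.
pose J (z : T) := [set l : seq T | size l = k].
rewrite (reindex_esum ([set: T] `*`` J) _ (fun p => p.1 :: p.2)); last first.
  split=> [[z l] [_ /= ->]//|[z l] [z' l'] _ _ [-> ->]//|[//|z l] [lk]].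
  by exists (z, l).
rewrite -(esum_esum (I := [set: T]) (J := J)
  (a := fun z l => (\prod_(y <- z :: l) w y)%:E)); last by move=> z l _ _; rewrite lee_fin.
transitivity (\esum_(z in [set: T]) ((b ^+ k)%:E * (w z)%:E)).
  apply: eq_esum => z _; under eq_esum do rewrite big_cons EFinM.
  by rewrite esumZ// ?IH 1?muleC// => l; rewrite lee_fin.
by rewrite esumZ ?exprn_ge0// ?wb -?EFinM ?exprSr// => z; rewrite lee_fin.
Qed.

(** A list with a point where to cut it amounts to a pair of lists. *)
Lemma esum_cut {T : countType} (f : seq T -> seq T -> R) :
  (forall l t, 0 <= f l t)%R ->
  \esum_(t in [set: seq T]) (\sum_(i < (size t).+1) f (take i t) (drop i t))%:E =
  \esum_(p in [set: seq T * seq T]) (f p.1 p.2)%:E.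
Proof.
move=> f0; pose J (t : seq T) := [set p : seq T * seq T | p.1 ++ p.2 = t].
transitivity (\esum_(t in [set: seq T]) \esum_(p in J t) (f p.1 p.2)%:E); last first.
  rewrite (esum_esum (J := J) (a := fun _ p => (f p.1 p.2)%:E)); last first.
    by move=> t p _ _; rewrite lee_fin.
  rewrite (reindex_esum [set: seq T * seq T] _ (fun p => (p.1 ++ p.2, p)))//.
  split=> [p _|p q _ _ [_]|[t p] [_ /= <-]]; rewrite /J//=.
  by exists p.
apply: eq_esum => t _; pose cut i := (take i t, drop i t).
have -> : J t = cut @` `I_(size t).+1.
  apply/seteqP; split=> [[l l'] /= lt|_ [i _ <-]]; last exact: cat_take_drop.
  exists (size l); first by rewrite /= ltnS -lt size_cat leq_addr.
  by rewrite /cut -lt take_size_cat ?drop_size_cat.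
rewrite esum_image; last first.
  move=> i j /[!inE]/= it jt [/(congr1 size) + _].
  by rewrite !size_takel.
rewrite esum_fset//; last by move=> i _; rewrite lee_fin.
by rewrite -fsbig_ord/= sumEFin.
Qed.

End EsumLists.

Section BranchingFormula.
Local Open Scope ereal_scope.
Context {R : realType} {T : countType}.
Variables (P : T -> T -> R) (mu : nat -> R) (m : R).
Hypothesis P_stochastic : stochastic P.
Hypothesis mu_m : offspring_distribution mu m.

Let P_ge0 x y : (0 <= P x y)%R. Proof. by case: P_stochastic. Qed.
Let mu_ge0 k : (0 <= mu k)%R. Proof. by case: mu_m. Qed.

Lemma offspring_law_ge0 y l : (0 <= offspring_law P mu y l)%R.
Proof. by rewrite mulr_ge0// prodr_ge0. Qed.

Lemma population_step_ge0 s t : (0 <= population_step P mu s t)%R.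
Proof.
elim: s t => [|y s IH] t /=; first exact: ler0n.
by apply: sumr_ge0 => i _; rewrite mulr_ge0// offspring_law_ge0.
Qed.

Lemma unmarked_ge0 (g : T -> R) (l : seq T) : unitf g ->
  (0 <= \prod_(z <- l) (1 - g z))%R.
Proof. by move=> g01; apply: prodr_ge0 => z _; rewrite subr_ge0; case/andP: (g01 z). Qed.

(** The children of a particle are independent: given that there are k of them,
    they are all unmarked with probability (1 - s)^k, s being the probability
    that a given child is marked. *)
Lemma offspring_law_unmarked (g : T -> R) y : unitf g ->
  \esum_(l in [set: seq T]) (offspring_law P mu y l * \prod_(z <- l) (1 - g z))%:E =
  (1 - branch P mu g y)%:E.
Proof.
move=> g01; pose w z := (P y z * (1 - g z))%R.
have w0 z : (0 <= w z)%R by rewrite mulr_ge0// subr_ge0; case/andP: (g01 z).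
have /andP[s0 s1] := avg01 P_stochastic y g01; set s := avg P g y in s0 s1.
have wE : \esum_(z in [set: T]) (w z)%:E = (1 - s)%:E.
  have e : 1 = s%:E + \esum_(z in [set: T]) (w z)%:E.
    rewrite (avgE P_stochastic)// -esumD => [|z _|z _]; last 2 first.
    - by rewrite mule_ge0// lee_fin//; case/andP: (g01 z).
    - by rewrite lee_fin.
    rewrite -[LHS](P_stochastic.2 y); apply: eq_esum => z _.
    by rewrite -EFinM -EFinD /w; congr EFin; lra.
  by move: e; case: esum => [x| |]//; rewrite -EFinD => -[e]; congr EFin; lra.
rewrite (_ : [set: seq T] = \bigcup_k [set l | size l = k]); last first.
  by apply/seteqP; split=> // l _; exists (size l).
rewrite esum_bigcupT; last 2 first.
- by move=> i j _ _ [l [/= -> ->]].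
- by move=> l; rewrite lee_fin mulr_ge0 ?offspring_law_ge0 ?unmarked_ge0.
transitivity (mean mu (fun k => ((1 - s) ^+ k)%:E)).
  apply: eq_esum => k _.
  rewrite -(esum_size k w0 wE) -esumZ//; last by move=> l; rewrite lee_fin prodr_ge0.
  apply: eq_esum => l /= lk; rewrite -EFinM /offspring_law lk -mulrA -big_split.
  by [].
have e : 1 = (psi mu s)%:E + mean mu (fun k => ((1 - s) ^+ k)%:E).
  have pk k : (0 <= (1 - s) ^+ k <= 1)%R.
    by rewrite exprn_ge0 ?exprn_ile1//; lra.
  rewrite (psiE mu_m)// -meanD// => [|k|k]; last 2 first.
  - by rewrite lee_fin subr_ge0; case/andP: (pk k).
  - by rewrite lee_fin; case/andP: (pk k).
  rewrite -[LHS](mean_cst mu_ge0 (@ler01 R) (offspring_mass mu_m)).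
  by apply: eq_mean => k _; rewrite -EFinD subrK.
rewrite /branch -/s; move: e; case: mean => [x| |]//.
by rewrite -EFinD => -[e]; congr EFin; lra.
Qed.

(** The particles reproduce independently: cutting the next population into the
    first block and the rest factors the sum. *)
Lemma population_step_unmarked (g : T -> R) s : unitf g ->
  \esum_(t in [set: seq T])
     (population_step P mu s t * \prod_(z <- t) (1 - g z))%:E =
  (\prod_(y <- s) (1 - branch P mu g y))%:E.
Proof.
move=> g01; elim: s => [|y s IH].
  rewrite (esum_supported (A := [set [::]])); last first.
    by move=> t /eqP tn; rewrite /= (negbTE tn) mul0r.
  by rewrite esum_set1 /= ?eqxx !big_nil ?mul1r.
pose F l t := (offspring_law P mu y l * \prod_(z <- l) (1 - g z) *
               (population_step P mu s t * \prod_(z <- t) (1 - g z)))%R.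
have F1 l : (0 <= offspring_law P mu y l * \prod_(z <- l) (1 - g z))%R.
  by rewrite mulr_ge0 ?offspring_law_ge0 ?unmarked_ge0.
have F2 t : (0 <= population_step P mu s t * \prod_(z <- t) (1 - g z))%R.
  by rewrite mulr_ge0 ?population_step_ge0 ?unmarked_ge0.
transitivity (\esum_(t in [set: seq T])
    (\sum_(i < (size t).+1) F (take i t) (drop i t))%:E).
  apply: eq_esum => t _; congr EFin; rewrite /= mulr_suml; apply: eq_bigr => i _.
  have -> : (\prod_(z <- t) (1 - g z) =
      \prod_(z <- take i t) (1 - g z) * \prod_(z <- drop i t) (1 - g z))%R.
    by rewrite -big_cat cat_take_drop.
  by rewrite /F/= mulrACA.
rewrite esum_cut; last by move=> l t; rewrite mulr_ge0.
rewrite (esum_prod F1 F2 IH) offspring_law_unmarked// -EFinM big_cons.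
by rewrite mulrC.
Qed.

End BranchingFormula.

Section CountablePartition.
Local Open Scope ereal_scope.
Context {d : measure_display} {Omega : measurableType d} {R : realType}.
Context {S : countType}.

Lemma measurable_preimage_countable (f : Omega -> S) (A : set S) :
  (forall s, measurable (f @^-1` [set s])) -> measurable (f @^-1` A).
Proof.
move=> mf.
pose F n : set Omega := if unpickle n is Some s then
  (if pselect (A s) then f @^-1` [set s] else set0) else set0.
have -> : f @^-1` A = \bigcup_n F n.
  apply/seteqP; split=> [w Aw|w [n _]].
    by exists (pickle (f w)) => //; rewrite /F pickleK; case: pselect.
  by rewrite /F; case: unpickle => // s; case: pselect => //= As ->.
apply: bigcupT_measurable => n; rewrite /F; case: unpickle => // s.
by case: pselect => As; [exact: mf|exact: measurable0].
Qed.

Lemma measure_partition (nu : {measure set Omega -> \bar R}) (f : Omega -> S)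
    (B : set Omega) : (forall s, measurable (f @^-1` [set s])) -> measurable B ->
  nu B = \esum_(s in [set: S]) nu (B `&` f @^-1` [set s]).
Proof.
move=> mf mB.
pose F n : set Omega := if @pickle_inv S n is Some s then B `&` f @^-1` [set s] else set0.
have mF n : measurable (F n).
  by rewrite /F; case: pickle_inv => // s; exact: measurableI.
have FE s : F (pickle s) = B `&` f @^-1` [set s] by rewrite /F pickleK_inv.
rewrite {1}(_ : B = \bigcup_n F n); last first.
  apply/seteqP; split=> [w Bw|w [n _]].
    by exists (pickle (f w)) => //; rewrite FE.
  by rewrite /F; case: pickle_inv => // s [].
rewrite measure_bigcup//=; last first.
  move=> i j _ _ [w []]; rewrite /F.
  have := @pickle_invK S i; have := @pickle_invK S j.
  case: pickle_inv => // s /= <-; case: pickle_inv => // s' /= <- [_ /= ->] [_ /= ->].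
  by [].
rewrite nneseries_esum; last by move=> n _; exact: measure_ge0.
rewrite (_ : mkset _ = [set: nat]); last by apply/seteqP; split=> // n _ /=; rewrite inE.
rewrite (esum_supported (A := pickle @` [set: S])); last first.
  move=> n nS; rewrite /F; have := @pickle_invK S n.
  case: pickle_inv => [s /= sn|_]; last by rewrite measure0.
  by case: nS; exists s.
rewrite esum_image; last by move=> s t _ _; apply: (pcan_inj pickleK).
by apply: eq_esum => s _; rewrite FE.
Qed.

End CountablePartition.

Section PathLaw.
Local Open Scope ereal_scope.
Context {R : realType} {T : countType} {d : measure_display} {Omega : measurableType d}.
Variables (P : T -> T -> R) (mu : nat -> R) (m : R).
Variables (Pr : T -> probability Omega R) (Z : nat -> Omega -> seq T).
Hypothesis P_stochastic : stochastic P.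
Hypothesis mu_m : offspring_distribution mu m.
Hypothesis Z_BMC : branching_Markov_chain P mu Pr Z.

Let P_ge0 x y : (0 <= P x y)%R. Proof. by case: P_stochastic. Qed.
Let mZ n s : measurable (Z n @^-1` [set s]). Proof. exact: Z_BMC.1. Qed.

Definition cylinder (A : nat -> set (seq T)) : set Omega :=
  [set w | forall i, A i (Z i w)].

Lemma measurable_cylinder A : measurable (cylinder A).
Proof.
have -> : cylinder A = \bigcap_i (Z i @^-1` A i).
  by apply/seteqP; split=> [w Aw i _|w Aw i]; [exact: Aw|exact: Aw].
by apply: bigcapT_measurable => i; exact: measurable_preimage_countable.
Qed.

Definition free_of (D : pred T) : set (seq T) := [set l | ~~ has D l].

(** The probability that a particle at y at time j has a descendant (itself
    included) in D i at one of the times i = j, ..., j+n-1.  Sets varying in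
    time are needed for visits in a time window. *)
Fixpoint meets (D : nat -> pred T) (n j : nat) (y : T) : R :=
  if n is n'.+1 then if D j y then 1%R else branch P mu (meets D n' j.+1) y else 0%R.

Lemma meets_unit D n j : unitf (meets D n j).
Proof.
elim: n j => [|n IH] j y /=; first by rewrite lexx ler01.
by case: ifP => _; [rewrite ler01 lexx|exact: (branch_unit P_stochastic mu_m)].
Qed.

(** The populations up to time j are prescribed, the next ones have to avoid
    the sets D i during n units of time, time j included. *)
Definition path_set (D : nat -> pred T) (n j : nat) (s : nat -> seq T) i :=
  [set l | ((i <= j)%N -> l = s i) /\ ((j <= i < j + n)%N -> free_of (D i) l)].

(** Induction on n, splitting according to the population at time j+1 and
    summing the Markov weights with [population_step_unmarked]. *)
Lemma path_law D n j s x :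
  Pr x (cylinder (path_set D n j s)) =
  ((s 0%N == [:: x])%:R * \prod_(i < j) population_step P mu (s i) (s i.+1) *
   \prod_(y <- s j) (1 - meets D n j y))%:E.
Proof.
elim: n j s => [|n IH] j s.
  rewrite (_ : cylinder _ = [set w | forall k, (k <= j)%N -> Z k w = s k]).
    rewrite Z_BMC.2; congr EFin; rewrite [X in (_ = _ * X)%R]big1 ?mulr1// => y _.
    by rewrite /= subr0.
  apply/seteqP; split=> w h i; first by move=> ij; apply: (h i).1.
  by split; [exact: h|rewrite addn0 => /andP[/leq_ltn_trans h']; move/h'; rewrite ltnn].
(* a forbidden particle at time j makes both sides vanish *)
have [Dj|fj] := boolP (has (D j) (s j)).
  rewrite (_ : cylinder _ = set0); last first.
    apply/seteqP; split=> // w h; have [/(_ (leqnn j)) -> f] := h j.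
    by move: f; rewrite leqnn -{1}(addn0 j) ltn_add2l => /(_ isT); rewrite /free_of/= Dj.
  rewrite measure0; case/hasP: Dj => y ysj Dy; congr EFin.
  suff -> : (\prod_(y <- s j) (1 - meets D n.+1 j y) = 0)%R by rewrite mulr0.
  by apply/eqP; rewrite prodf_seq_eq0; apply/hasP; exists y => //=; rewrite Dy subrr.
rewrite (measure_partition _ (mZ j.+1) (measurable_cylinder _)).
(* s' t prolongs the path s by the population t *)
pose s' t i := if i == j.+1 then t else s i.
have s'j t i : (i <= j)%N -> s' t i = s i by rewrite /s'; case: eqP => // ->; rewrite ltnn.
set c := ((s 0%N == [:: x])%:R * _)%R.
have c0 : (0 <= c)%R.
  by rewrite mulr_ge0// prodr_ge0// => i _; exact: (population_step_ge0 P_stochastic mu_m).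
pose a t := (population_step P mu (s j) t * \prod_(z <- t) (1 - meets D n j.+1 z))%R.
transitivity (\esum_(t in [set: seq T]) (c%:E * (a t)%:E)); last first.
  rewrite esumZ//; last first.
    move=> t; rewrite lee_fin mulr_ge0//; first exact: (population_step_ge0 P_stochastic mu_m).
    by apply: unmarked_ge0; exact: meets_unit.
  rewrite (population_step_unmarked P_stochastic mu_m) -?EFinM; last exact: meets_unit.
  congr (_ * _)%:E; apply: eq_big_seq => y ysj /=.
  by case: ifPn => // Dy; case/hasP: fj; exists y.
apply: eq_esum => t _.
rewrite (_ : _ `&` _ = cylinder (path_set D n j.+1 (s' t))).
  apply: (etrans (IH _ _)); rewrite -EFinM; congr EFin; rewrite big_ord_recr /= /s' eqxx.
  rewrite [in RHS]/c /a -!mulrA; congr (_ * _)%R.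
  rewrite (ltn_eqF (ltnSn j)); congr (_ * _)%R.
  apply: eq_bigr => i _; rewrite eqSS !ltn_eqF//.
  by rewrite ltnS ltnW.
apply/seteqP; split=> w.
  move=> [h /= Zt] i; split.
    rewrite leq_eqVlt => /predU1P[->|ij]; first by rewrite /s' eqxx.
    by rewrite s'j//; apply: (h i).1.
  by move=> /andP[ji ijn]; apply: (h i).2; rewrite ltnW//= addnS -addSn.
move=> h; split; last by have := (h j.+1).1 (leqnn _); rewrite /s' eqxx.
move=> i; split=> [ij|/andP[ji ijn]].
  by have := (h i).1 (leqW ij); rewrite s'j.
move: ji; rewrite leq_eqVlt => /predU1P[<-|ji].
  by have := (h j).1 (leqnSn j); rewrite s'j// => ->.
by apply: (h i).2; rewrite ji /= addSn -addnS.
Qed.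

Lemma avoid_law D n x :
  Pr x (cylinder (fun i => [set l | (i < n)%N -> free_of (D i) l])) =
  (1 - meets D n 0 x)%:E.
Proof.
rewrite (measure_partition _ (mZ 0%N) (measurable_cylinder _)).
transitivity (\esum_(t in [set: seq T])
  ((t == [:: x])%:R * \prod_(y <- t) (1 - meets D n 0 y))%:E).
  apply: eq_esum => t _.
  rewrite (_ : _ `&` _ = cylinder (path_set D n 0 (fun=> t))).
    by apply: (etrans (path_law _ _ _ _ _)); rewrite big_ord0 mulr1.
  apply/seteqP; split=> w.
    move=> [h /= Zt] i; split; first by rewrite leqn0 => /eqP ->.
    by rewrite add0n /= => ilt; exact: h.
  by move=> h; split=> [i ilt|]; [apply: (h i).2|apply: (h 0%N).1].
rewrite (esum_supported (A := [set [:: x]])); last first.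
  by move=> t /eqP tx; rewrite (negbTE tx) mul0r.
have m01 := meets_unit D n 0 x; case/andP: m01 => m0 m1.
by rewrite esum_set1 eqxx mul1r big_seq1// lee_fin subr_ge0.
Qed.

Definition late_visit (x : T) (N : nat) : nat -> pred T :=
  fun i => [pred y | (N <= i)%N && (y == x)].

Lemma meets_late_visit x N k : meets (late_visit x N) (N + k) 0 = visit P mu x N k.
Proof.
have after n j : (N <= j)%N -> meets (late_visit x N) n j = hit_before P mu x n.
  elim: n j => [//|n IH] j Nj; apply/funext => y /=.
  by rewrite -[late_visit x N j y]/((N <= j)%N && (y == x)) Nj IH// ltnW.
suff before i j : (i + j = N)%N ->
    meets (late_visit x N) (i + k) j = visit P mu x i k by apply: before; rewrite addn0.
elim: i j => [|i IH] j ijN; first by rewrite add0n after// -ijN.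
apply/funext => y /=; rewrite -[late_visit x N j y]/((N <= j)%N && (y == x)).
by rewrite IH ?addnS -?addSn// leqNgt -ijN addSn ltnS leq_addl.
Qed.

Definition avoid_between (x : T) (N k : nat) : set Omega :=
  [set w | forall i, (N <= i < N + k)%N -> x \notin Z i w].

Lemma avoid_betweenE x N k : avoid_between x N k =
  cylinder (fun i => [set l | (i < N + k)%N -> free_of (late_visit x N i) l]).
Proof.
apply/seteqP; split=> w h i.
  move=> iNk; apply/hasPn => y yZ; apply/negP => /andP[Ni /eqP yx].
  by have := h i; rewrite Ni iNk => /(_ isT); rewrite -yx yZ.
move=> /andP[Ni iNk]; apply/negP => xZ; have := h i iNk.
by move=> /hasPn/(_ x xZ)/negP; apply; apply/andP.
Qed.

Lemma avoid_between_law x N k : Pr x (avoid_between x N k) = (1 - visit P mu x N k x)%:E.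
Proof. by rewrite avoid_betweenE avoid_law meets_late_visit. Qed.

Lemma measurable_avoid_between x N k : measurable (avoid_between x N k).
Proof. by rewrite avoid_betweenE; exact: measurable_cylinder. Qed.

Definition avoid_after (x : T) (N : nat) : set Omega := \bigcap_k avoid_between x N k.

Lemma measurable_avoid_after x N : measurable (avoid_after x N).
Proof. by apply: bigcapT_measurable => k; exact: measurable_avoid_between. Qed.

Lemma avoid_afterP x N w : avoid_after x N w <-> forall i, (N <= i)%N -> x \notin Z i w.
Proof.
split=> [h i Ni|h k _ i /andP[Ni _]]; last exact: h.
by apply: (h (i - N).+1 I i); rewrite Ni addnS subnKC//=.
Qed.

Lemma avoid_after_law x N : Pr x (avoid_after x N) = (1 - late P mu x N x)%:E.
Proof.
have c1 : (fun k => Pr x (avoid_between x N k)) @ \oo --> Pr x (avoid_after x N).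
  apply: nonincreasing_cvg_mu.
  - apply: le_lt_trans (probability_le1 _ _) (ltry _).
    exact: measurable_avoid_between.
  - by move=> k; exact: measurable_avoid_between.
  - exact: measurable_avoid_after.
  - move=> k l kl; apply/subsetPset => w h i /andP[Ni ik]; apply: h.
    by rewrite Ni (leq_trans ik)// leq_add2l.
have c2 : (fun k => Pr x (avoid_between x N k)) @ \oo --> (1 - late P mu x N x)%:E.
  under eq_fun do rewrite avoid_between_law.
  apply: cvg_EFin; first exact: nearW.
  by apply: cvgB; [exact: cvg_cst|exact: (cvg_visit P_stochastic mu_m)].
by rewrite -(cvg_lim _ c1)// -(cvg_lim _ c2).
Qed.

(** Populations are finite, so infinitely many visits means visits at
    arbitrarily late times. *)
Lemma infinite_visitsP x w :
  \sum_(1 <= n <oo) (\sum_(y <- Z n w) (y == x)%:R)%:E = +oo :> \bar R <->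
  ~ (\bigcup_N avoid_after x N) w.
Proof.
pose c n : R := (\sum_(y <- Z n w) (y == x)%:R)%R.
have c0 n : (0 <= c n)%R by apply: sumr_ge0 => y _; exact: ler0n.
have c00 n : x \notin Z n w -> c n = 0%R.
  move=> xZ; rewrite /c big1_seq// => y /= yZ; case: eqP => // yx.
  by move: xZ; rewrite -yx yZ.
have c1 n : x \in Z n w -> (1 <= c n)%R.
  by move=> xZ; rewrite /c (big_rem _ xZ)/= eqxx lerDl sumr_ge0// => y _; exact: ler0n.
rewrite -/(c _); split=> [coo [N _ /avoid_afterP av]|nav].
  move: coo; rewrite (nneseries_split _ N); last by move=> n _; exact: c0.
  rewrite eseries0 ?adde0; last first.
    by move=> n Nn _; congr EFin; apply: c00; apply: av; rewrite (leq_trans _ Nn)// leq_addr.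
  by rewrite sumEFin.
apply/eqP; rewrite -leye_eq leNgt; apply/negP => fin.
have fin0 : \sum_(0 <= n <oo) (c n)%:E < +oo.
  rewrite (nneseries_split _ 1); last by move=> n _; exact: c0.
  by rewrite add0n sumEFin lte_add_pinfty ?ltry.
have := nneseries_tail_cvg fin0 (fun n _ => c0 n).
move=> /fine_cvgP[_ /cvgrPdist_lt/(_ _ ltr01)[N _ hN]].
apply: nav; exists N => //; apply/avoid_afterP => i Ni; apply/negP => xZ.
have := hN N (leqnn N); rewrite /= sub0r normrN ger0_norm; last first.
  by apply: fine_ge0; apply: nneseries_ge0 => n _ _; rewrite lee_fin.
apply/negP; rewrite -leNgt -lee_fin fineK; last first.
  rewrite ge0_fin_numE; last by apply: nneseries_ge0 => n _ _; rewrite lee_fin.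
  apply: le_lt_trans fin0; rewrite [leRHS](nneseries_split _ N) ?add0n; last first.
    by move=> n _; exact: c0.
  by rewrite leeDr// sume_ge0// => n _; exact: c0.
apply: (@le_trans _ _ (\sum_(N <= n < i.+1) (c n)%:E)); last first.
  by apply: nneseries_lim_ge => n _ _; rewrite lee_fin.
rewrite big_nat_recr//= sumEFin -EFinD lee_fin (le_trans (c1 i xZ))// lerDr.
exact: sumr_ge0.
Qed.

(** Continuity of the measure along the increasing events that x is not visited
    after time N. *)
Lemma cvg_late_return x :
  (fun N => (late P mu x N x)%:E) @ \oo --> return_probability Pr Z x.
Proof.
pose U := \bigcup_N avoid_after x N.
have mU : measurable U by apply: bigcupT_measurable => N; exact: measurable_avoid_after.
have -> : return_probability Pr Z x = 1 - Pr x U.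
  rewrite -probability_setC//; congr (Pr x _); apply/seteqP.
  by split=> w /= /infinite_visitsP.
have c : (fun N => Pr x (avoid_after x N)) @ \oo --> Pr x U.
  apply: nondecreasing_cvg_mu => //; first by move=> N; exact: measurable_avoid_after.
  move=> k l kl; apply/subsetPset => w /avoid_afterP h; apply/avoid_afterP => i li.
  by apply: h; exact: leq_trans li.
rewrite (_ : (fun N => _) = fun N => 1 - Pr x (avoid_after x N)); last first.
  by apply/funext => N; rewrite avoid_after_law -EFinB; congr EFin; lra.
apply: cvgeB => //.
exact: cvg_cst.
Qed.

End PathLaw.

(** * Return probabilities *)

Section ReturnProbability.
Local Open Scope ereal_scope.
Context {R : realType} {T : countType} {d : measure_display} {Omega : measurableType d}.
Variables (P : T -> T -> R) (mu : nat -> R) (m : R).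
Variables (Pr : T -> probability Omega R) (Z : nat -> Omega -> seq T).
Hypothesis P_stochastic : stochastic P.
Hypothesis P_irreducible : irreducible P.
Hypothesis mu_m : offspring_distribution mu m.
Hypothesis Z_BMC : branching_Markov_chain P mu Pr Z.

Lemma return_probability_ge0 x : 0 <= return_probability Pr Z x.
Proof. exact: measure_ge0. Qed.

Lemma return_probability_le_late x N :
  return_probability Pr Z x <= (late P mu x N x)%:E.
Proof.
have c := cvg_late_return (x := x) P_stochastic mu_m Z_BMC.
rewrite -(cvg_lim _ c)//; apply: lime_le; first by apply/cvg_ex; eexists; exact: c.
exists N => // n /= Nn; rewrite lee_fin.
exact: (late_ni P_stochastic mu_m).
Qed.

Lemma return_probability_ge x (e : R) : (forall N, (e <= late P mu x N x)%R) ->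
  e%:E <= return_probability Pr Z x.
Proof.
have c := cvg_late_return (x := x) P_stochastic mu_m Z_BMC.
move=> el; rewrite -(cvg_lim _ c)//; apply: lime_ge; first by apply/cvg_ex; eexists; exact: c.
exact: nearW.
Qed.

Lemma return_probability_le1 x : return_probability Pr Z x <= 1.
Proof.
apply: le_trans (return_probability_le_late x 0) _; rewrite lee_fin.
by case/andP: (late_unit P_stochastic mu_m x 0 x).
Qed.

(** Since [late x N x] decreases to the return probability, the latter is 1 only
    if all [late x N x] are. *)
Lemma return_probability1P x :
  return_probability Pr Z x = 1 <-> (forall y, hit P mu x y = 1%R).
Proof.
rewrite -(late1P P_stochastic mu_m P_irreducible x); split=> [r1 N|l1].
  apply/eqP; rewrite eq_le; case/andP: (late_unit P_stochastic mu_m x N x) => _ ->/=.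
  by rewrite -lee_fin -r1; exact: return_probability_le_late.
apply/eqP; rewrite eq_le return_probability_le1/=.
by apply: return_probability_ge => N; rewrite l1.
Qed.

Lemma return_probability0P r x : (1 < m)%R \/ transient P ->
  return_probability Pr Z x = 0 <-> m%:E <= (spectral_radius P r r)^-1.
Proof.
move=> nondeg; have m1 := mean_offspring_ge1 mu_m.
have m0 : (0 < m)%R by exact: lt_le_trans m1.
split=> [r0|/(le_inv_spectral_radiusP P_stochastic r m0) rm1].
  apply/(le_inv_spectral_radiusP P_stochastic r m0).
  apply: (return_mass_le1_change_root P_stochastic P_irreducible r m0 (x := x)) => k.
  rewrite leNgt; apply/negP => /(supercritical_survival P_stochastic mu_m)[e e0].
  by move=> /return_probability_ge; rewrite r0 lee_fin leNgt e0.
have l0 : (late P mu x ^~ x @ \oo --> (0 : R))%R.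
  have [m_gt1|m_le1] := ltP 1%R m.
    apply: (critical_extinction P_stochastic mu_m m_gt1).
    exact: (return_mass_le1_change_root P_stochastic P_irreducible x m0 rm1).
  case: nondeg => [|tr]; first by rewrite ltNge m_le1.
  have mE : m = 1%R by apply/eqP; rewrite eq_le m_le1.
  exact: (transient_extinction P_stochastic mu_m x mE tr).
have c := cvg_late_return (x := x) P_stochastic mu_m Z_BMC.
rewrite -(cvg_lim _ c)//; apply/cvg_lim => //.
by apply: cvg_EFin; [exact: nearW|exact: l0].
Qed.

End ReturnProbability.

Lemma spectral_radius_inv_ge1 {R : realType} {T : countType} (P : T -> T -> R) x :
  stochastic P -> (1 <= (spectral_radius P x x)^-1)%E.
Proof.
move=> P_stochastic; have [P_ge0 P_sum] := P_stochastic.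
have nstep_le1 n y : (nstep P n y x <= 1)%E.
  elim: n y => [|n IH] y /=; first by rewrite lee_fin lern1 leq_b1.
  rewrite -[leRHS](mean_cst (P_ge0 y) (@ler01 R) (P_sum y)).
  by apply: le_mean => // z _; exact: IH.
apply: (spectral_radius_le_inv P_stochastic ltr01) => n.
by rewrite expr1n mul1e.
Qed.

(** For m <= 1/rho [late x N x] tends to 0 by [critical_extinction], so x cannot
    be hit almost surely from everywhere. *)
Lemma quasi_transitive_hit1 {R : realType} {T : countType} (E : rel T)
    (P : T -> T -> R) (mu : nat -> R) (m : R) x :
  stochastic P -> irreducible P -> quasi_transitive E P ->
  offspring_distribution mu m -> 1 < m ->
  (forall y, hit P mu x y = 1) <-> ((spectral_radius P x x)^-1 < m%:E)%E.
Proof.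
move=> Ps Pi Pq mu_m m1; split=> [hx|]; last exact: (strong_recurrence Ps Pi mu_m Pq).
rewrite ltNge; apply/negP; have m0 : 0 < m by lra.
move=> /(le_inv_spectral_radiusP Ps x m0) /(critical_extinction Ps mu_m m1) l0.
have /(late1P Ps mu_m Pi) l1 := hx.
have l1' : late P mu x ^~ x @ \oo --> (1 : R).
  by under eq_fun do rewrite l1; exact: cvg_cst.
have : (1 : R) = 0 by rewrite -(cvg_lim _ l0)// -(cvg_lim _ l1').
by move/eqP; rewrite oner_eq0.
Qed.

Theorem theorem3p14 (R : realType) (I : countType) (X : I -> countType)
  (P : forall i, X i -> X i -> R) (E : forall i, rel (X i))
  (r : forall i, X i) (a : I -> R) (mu : nat -> R) (m : R)
  (d : measure_display) (Omega : measurableType d)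
  (Pr : glued r -> probability Omega R) (Z : nat -> Omega -> seq (glued r))
  (X_infinite : forall i, infinite_set [set: X i])
  (P_stochastic : forall i, stochastic (P i))
  (P_irreducible : forall i, irreducible (P i))
  (P_quasi_transitive : forall i, quasi_transitive (E i) (P i))
  (a_weights : root_weights a)
  (mu_offspring : offspring_distribution mu m)
  (nondegenerate : 1 < m \/ transient (glued_chain r P a))
  (Z_BMC : branching_Markov_chain (glued_chain r P a) mu Pr Z) :
  let rho_i i := spectral_radius (P i) (r i) (r i) in
  let rho := spectral_radius (glued_chain r P a) (common_root r) (common_root r) in
  let varrho := ereal_inf (range rho_i) in
  let attained := exists i, rho_i i = varrho in
  let alpha := return_probability Pr Z in
  [/\ (m%:E <= rho^-1)%E <-> (forall x, alpha x = 0%E),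
      m%:E <> (varrho^-1)%E ->
        ((rho^-1 < m%:E)%E /\ (m%:E < varrho^-1)%E <->
         (forall x, (0 < alpha x)%E /\ (alpha x < 1)%E)),
      m%:E <> (varrho^-1)%E ->
        ((varrho^-1 < m%:E)%E <-> (forall x, alpha x = 1%E)),
      attained -> m%:E = (varrho^-1)%E -> (forall x, (alpha x < 1)%E) &
      ~ attained -> m%:E = (varrho^-1)%E -> (forall x, alpha x = 1%E)].
Proof.
move=> rho_i rho varrho attained alpha.
pose Q := glued_chain r P a.
have Q_stochastic : stochastic Q by exact: glued_stochastic.
have Q_irreducible : irreducible Q by exact: glued_irreducible.
have m1 := mean_offspring_ge1 mu_offspring.
have alpha0 x : alpha x = 0%E <-> (m%:E <= rho^-1)%E.
  exact: (return_probability0P Q_stochastic Q_irreducible mu_offspring Z_BMC).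
have alpha_le1 x : (alpha x <= 1)%E.
  exact: (return_probability_le1 Q_stochastic mu_offspring Z_BMC).
have alpha_ge0 x : (0 <= alpha x)%E by exact: return_probability_ge0.
have [i0] : exists i : I, True.
  apply: contrapT => nI; have := a_weights.2; rewrite esum1.
    by move=> /eqP; rewrite eqe eq_sym oner_eq0.
  by move=> i _; case: nI; exists i.
move=> _.
have alpha1 x : alpha x = 1%E <-> (forall i, (rho_i i)^-1 < m%:E)%E.
  (* for m = 1 both sides are false: alpha vanishes and rho_i <= 1 *)
  have [m_gt1|m_le1] := ltP 1 m; last first.
    have mE : m = 1 by apply/eqP; rewrite eq_le m_le1.
    split=> [ax|/(_ i0)]; last first.
      by rewrite mE ltNge spectral_radius_inv_ge1.
    have : alpha x = 0%E by apply/alpha0; rewrite mE; exact: spectral_radius_inv_ge1.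
    by rewrite ax => /eqP; rewrite eqe oner_eq0.
  split=> [|rho_m]; rewrite (return_probability1P Q_stochastic Q_irreducible mu_offspring Z_BMC).
    move=> hx i; apply/(quasi_transitive_hit1 (r i) (P_stochastic i)
      (P_irreducible i) (P_quasi_transitive i) mu_offspring m_gt1) => z.
    rewrite -(@hit_glued _ _ _ r P a).
    exact: (hit1_change_target Q_stochastic mu_offspring Q_irreducible (common_root r) m_gt1 hx).
  apply: (hit1_change_target Q_stochastic mu_offspring Q_irreducible x (x := common_root r) m_gt1).
  apply: (glued_ind (S := fun y => hit Q mu (common_root r) y = 1)) => [|i z]; first exact: (hit_self Q_stochastic mu_offspring).
  rewrite hit_glued//; move: z; apply/(quasi_transitive_hit1 (r i) (P_stochastic i)
      (P_irreducible i) (P_quasi_transitive i) mu_offspring m_gt1).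
  exact: rho_m.
have rho_i0 i : (0 <= rho_i i)%E by exact: spectral_radius_ge0.
have varrho0 : (0 <= varrho)%E by apply: le_ereal_inf_tmp => _ [i _ <-].
have rho_i_varrho i : ((rho_i i)^-1 <= varrho^-1)%E.
  by rewrite lee_pV2 ?inE//; apply: ereal_inf_lbound; exists i.
have above : (varrho^-1 < m%:E)%E -> forall i, ((rho_i i)^-1 < m%:E)%E.
  by move=> h i; apply: le_lt_trans h.
have below : (m%:E < varrho^-1)%E -> ~ forall i, ((rho_i i)^-1 < m%:E)%E.
  rewrite inve_pgt ?inE//; last by rewrite lee_fin (le_trans ler01).
  move=> /ereal_inf_lt[_ [i _ <-]] h /(_ i); apply/negP; rewrite -leNgt.
  by rewrite inve_pge ?inE ?(ltW h)// lee_fin (le_trans ler01).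
have root := common_root r.
split.
- by split=> [h x|/(_ root)/alpha0//]; apply/alpha0.
- move=> ne; split=> [[rho_m m_varrho] x|al].
    split; first by rewrite lt_neqAle alpha_ge0 andbT eq_sym; apply/eqP => /alpha0; rewrite leNgt rho_m.
    by rewrite lt_neqAle alpha_le1 andbT; apply/eqP => /alpha1; exact: below.
  have [a0 a1] := al root; split.
    by rewrite ltNge; apply/negP => /(alpha0 root) e; rewrite e ltxx in a0.
  rewrite lt_neqAle (introN eqP ne)/= leNgt; apply/negP => /above/(alpha1 root) e.
  by rewrite e ltxx in a1.
- move=> ne; split=> [h x|/(_ root)/alpha1 al]; first by apply/alpha1; exact: above.
  rewrite lt_neqAle eq_sym (introN eqP ne)/= leNgt; apply/negP => /below; exact.
- move=> [i ei] me x; rewrite lt_neqAle alpha_le1 andbT; apply/eqP => /alpha1/(_ i).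
  by rewrite ei me ltxx.
- move=> natt me x; apply/alpha1 => i; rewrite me lt_neqAle rho_i_varrho andbT.
  by apply/eqP => e; apply: natt; exists i; rewrite -[LHS]inveK e inveK.
Qed.
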